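(* Let $k$ be an algebraically closed field and let $P$ be a finite connected poset. Let $G(P)$ be the unit group of the incidence monoid $I(P)$, let $T$ be a maximal torus of $G(P)$, and let $T\times T$ act on $I(P)$ by $(s,t)\cdot x = s x t^{-1}$. Then the complexity of this action is $$c_{T\times T}(I(P)) = Z(P,3)-2Z(P,2)+1,$$ where $Z(P,\cdot)$ is the zeta polynomial of $P$.
   Context: The incidence monoid $I(P)=\{f:P\times P\to k : f(x,y)=0 \text{ unless } x\le y\}$ has convolution product $(f\cdot g)(x,y)=\sum_{x\le z\le y} f(x,z)g(z,y)$; it is an affine space and a linear algebraic monoid. A poset is connected if the underlying undirected graph of its Hasse diagram is connected. For a torus $S$ acting on an irreducible variety $X$, the complexity $c_S(X)$ is the transcendence degree over $k$ of the field $k(X)^S$ of $S$-invariant rational functions; equivalently $c_S(X)=\dim X-\max\{\dim S\cdot x : x\in X\}$. The zeta polynomial $Z(P,n)$ is the unique polynomial function on $\mathbb{Z}$ such that for $n\ge 2$, $Z(P,n)$ is the number of multichains $t_1\le t_2\le\cdots\le t_{n-1}$ in $P$ (so $Z(P,2)=|P|$ and $Z(P,3)$ is the number of pairs $(x,y)$ with $x\le y$). *)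

(* Defs.v *)
From HB Require Import structures.
From mathcomp Require Import all_boot all_order all_algebra.
From mathcomp Require Import generic_quotient mpoly ring.

Set Implicit Arguments.
Unset Strict Implicit.
Unset Printing Implicit Defensive.

Import Order.TTheory GRing.Theory Num.Theory.
Local Open Scope ring_scope.

Section Posets.

Context {d : Order.disp_t} (P : finPOrderType d).

Definition covers : rel P :=
  [rel x y | (x < y)%O && [forall z, ~~ ((x < z)%O && (z < y)%O)]].

(* A connected graph is nonempty. *)
Definition connected_poset : Prop :=
  (0 < #|P|)%N /\
  forall x y : P, connect [rel u v | covers u v || covers v u] x y.

Definition multichains (m : nat) : {set m.-tuple P} :=
  [set t : m.-tuple P | sorted <=%O t].

(* Polynomial functions Z -> Z are represented by rational polynomials: such a
   function may be, e.g., n |-> n * (n - 1) / 2. *)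
Definition is_zeta_poly (Z : {poly rat}) : Prop :=
  forall n : nat, (2 <= n)%N -> Z.[n%:R] = #|multichains n.-1|%:R.

End Posets.

Arguments is_zeta_poly {d} P Z.
Arguments connected_poset {d} P.
Arguments multichains {d} P m.

Section IncidenceMonoid.

Context (k : fieldType) {d : Order.disp_t} (P : finPOrderType d).

Definition le_supported : pred {ffun P * P -> k} :=
  [pred f : {ffun P * P -> k} | [forall p : P * P, (p.1 <= p.2)%O || (f p == 0)]].

Record incidence : Type :=
  Incidence { inc_fun :> {ffun P * P -> k}; _ : le_supported inc_fun }.

HB.instance Definition _ := [isSub for inc_fun].
HB.instance Definition _ := [Choice of incidence by <:].

Lemma le_supportedP (f : {ffun P * P -> k}) :
  reflect (forall x y, ~~ (x <= y)%O -> f (x, y) = 0) (le_supported f).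
Proof.
apply: (iffP forallP) => [Hf x y /negPf nxy|Hf [x y] /=].
  by have := Hf (x, y); rewrite /= nxy => /eqP.
by case: (boolP (x <= y)%O) => // /Hf ->; rewrite eqxx.
Qed.

Lemma inc_eq0 (f : incidence) x y : ~~ (x <= y)%O -> f (x, y) = 0.
Proof. by case: f => f /= /le_supportedP; apply. Qed.

Lemma incP (f g : incidence) : (forall x y, f (x, y) = g (x, y)) <-> f = g.
Proof.
split=> [E|-> //]; apply: val_inj; apply/ffunP => -[x y]; exact: E.
Qed.

Fact le_supported_zmod : zmod_closed le_supported.
Proof.
split=> [|f g /le_supportedP Hf /le_supportedP Hg].
  by apply/le_supportedP => x y _; rewrite ffunE.
by apply/le_supportedP => x y nxy; rewrite !ffunE Hf // Hg // subrr.
Qed.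
HB.instance Definition _ :=
  GRing.isZmodClosed.Build _ le_supported le_supported_zmod.
HB.instance Definition _ := [SubChoice_isSubZmodule of incidence by <:].

Definition conv_fun (f g : {ffun P * P -> k}) : {ffun P * P -> k} :=
  [ffun p => \sum_(z | (p.1 <= z <= p.2)%O) f (p.1, z) * g (z, p.2)].

Definition id_fun : {ffun P * P -> k} := [ffun p => (p.1 == p.2)%:R].

Fact conv_subproof f g : le_supported (conv_fun f g).
Proof.
apply/le_supportedP => x y /negPf nxy; rewrite ffunE /= big_pred0 // => z.
by apply/negP => /andP[/le_trans h /h]; rewrite nxy.
Qed.

Fact id_subproof : le_supported id_fun.
Proof.
apply/le_supportedP => x y nxy; rewrite ffunE /=; case: eqP nxy => // ->.
by rewrite lexx.
Qed.

Definition inc_conv (f g : incidence) : incidence :=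
  Incidence (conv_subproof f g).
Definition inc_id : incidence := Incidence id_subproof.

Lemma inc_convE (f g : incidence) x y :
  inc_conv f g (x, y) = \sum_z f (x, z) * g (z, y).
Proof.
rewrite ffunE /= big_mkcond /=; apply: eq_bigr => z _.
case: (boolP (x <= z)%O) => [_|/inc_eq0 ->]; last by rewrite mul0r.
by case: (boolP (z <= y)%O) => [//|/inc_eq0 ->]; rewrite mulr0.
Qed.

Fact inc_convA : associative inc_conv.
Proof.
move=> f g h; apply/incP => x y; rewrite !inc_convE.
under eq_bigr => z _ do rewrite inc_convE mulr_sumr.
rewrite exchange_big /=; apply: eq_bigr => w _.
by rewrite inc_convE mulr_suml; apply: eq_bigr => z _; rewrite mulrA.
Qed.

Fact inc_conv1f : left_id inc_id inc_conv.
Proof.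
move=> f; apply/incP => x y; rewrite inc_convE (bigD1 x) //= ffunE eqxx mul1r.
rewrite big1 ?addr0 // => z /negPf nzx.
by rewrite ffunE /= eq_sym nzx mul0r.
Qed.

Fact inc_convf1 : right_id inc_id inc_conv.
Proof.
move=> f; apply/incP => x y; rewrite inc_convE (bigD1 y) //= ffunE eqxx mulr1.
by rewrite big1 ?addr0 // => z /negPf nzy; rewrite ffunE /= nzy mulr0.
Qed.

Lemma inc_addE (f g : incidence) x y : (f + g) (x, y) = f (x, y) + g (x, y).
Proof. by rewrite [LHS]ffunE. Qed.

Fact inc_convDl : left_distributive inc_conv +%R.
Proof.
move=> f g h; apply/incP => x y; rewrite inc_addE !inc_convE -big_split.
by apply: eq_bigr => z _; rewrite inc_addE mulrDl.
Qed.

Fact inc_convDr : right_distributive inc_conv +%R.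
Proof.
move=> f g h; apply/incP => x y; rewrite inc_addE !inc_convE -big_split.
by apply: eq_bigr => z _; rewrite inc_addE mulrDr.
Qed.

HB.instance Definition _ := GRing.Zmodule_isPzRing.Build incidence
  inc_convA inc_conv1f inc_convf1 inc_convDl inc_convDr.

Lemma inc_mulE (f g : incidence) x y :
  (f * g) (x, y) = \sum_(z | (x <= z <= y)%O) f (x, z) * g (z, y).
Proof. by rewrite ffunE. Qed.

(* Coordinates identifying I(P) with affine space; the coordinate ring of I(P)
   is {mpoly k[inc_dim]}. *)
Definition interval : predArgType := {p : P * P | (p.1 <= p.2)%O}.

Definition inc_dim : nat := #|{: interval}|.

Definition inc_coord (x : incidence) : 'I_inc_dim -> k :=
  fun i => x (val (enum_val i)).

Definition inc_of_fun (c : 'I_inc_dim -> k) : {ffun P * P -> k} :=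
  [ffun p => if (insub p : option interval) is Some q then c (enum_rank q)
             else 0].

Fact inc_of_subproof c : le_supported (inc_of_fun c).
Proof. by apply/le_supportedP => x y nxy; rewrite ffunE insubN. Qed.

Definition inc_of (c : 'I_inc_dim -> k) : incidence :=
  Incidence (inc_of_subproof c).

Lemma inc_ofK c : inc_coord (inc_of c) =1 c.
Proof. by move=> i; rewrite /inc_coord ffunE valK enum_valK. Qed.

Lemma inc_coordK x : inc_of (inc_coord x) = x.
Proof.
apply/incP => u v; rewrite ffunE; case: insubP => [q _ Eq|/inc_eq0 -> //].
by rewrite /inc_coord enum_rankK Eq.
Qed.

(* The unit group: a unit is stored together with its (unique) inverse. *)
Record inc_unit : Type := IncUnit {
  unit_val_inv : incidence * incidence;
  _ : (unit_val_inv.1 * unit_val_inv.2 == 1)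
      && (unit_val_inv.2 * unit_val_inv.1 == 1) }.

HB.instance Definition _ := [isSub for unit_val_inv].
HB.instance Definition _ := [Choice of inc_unit by <:].

Definition uval (g : inc_unit) : incidence := (unit_val_inv g).1.
Definition uinv (g : inc_unit) : incidence := (unit_val_inv g).2.

Lemma uvalV g : uval g * uinv g = 1.
Proof. by case: g => -[a b] ab; case/andP: (ab) => /eqP. Qed.

Lemma uvalVl g : uinv g * uval g = 1.
Proof. by case: g => -[a b] ab; case/andP: (ab) => _ /eqP. Qed.

Lemma uval_inj : injective uval.
Proof.
move=> g h E; apply: val_inj.
rewrite (surjective_pairing (val g)) (surjective_pairing (val h)).
rewrite -/(uval g) -/(uinv g) -/(uval h) -/(uinv h) E; congr pair.
by rewrite -[LHS]mulr1 -(uvalV h) mulrA -E uvalVl mul1r.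
Qed.

Fact unit_one_subproof :
  ((1 : incidence) * 1 == 1) && ((1 : incidence) * 1 == 1).
Proof. by rewrite mulr1 eqxx. Qed.
Definition unit_one : inc_unit := @IncUnit (1, 1) unit_one_subproof.

Fact unit_mul_subproof g h :
  (uval g * uval h * (uinv h * uinv g) == 1)
  && (uinv h * uinv g * (uval g * uval h) == 1).
Proof.
rewrite -mulrA (mulrA (uval h)) uvalV mul1r uvalV eqxx /=.
by rewrite -mulrA (mulrA (uinv g)) uvalVl mul1r uvalVl.
Qed.
Definition unit_mul g h : inc_unit :=
  @IncUnit (uval g * uval h, uinv h * uinv g) (unit_mul_subproof g h).

Fact unit_inv_subproof g :
  (uinv g * uval g == 1) && (uval g * uinv g == 1).
Proof. by rewrite uvalV uvalVl eqxx. Qed.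
Definition unit_inv g : inc_unit :=
  @IncUnit (uinv g, uval g) (unit_inv_subproof g).

Fact unit_mulA : associative unit_mul.
Proof. by move=> f g h; apply: uval_inj; rewrite /uval /= mulrA. Qed.
Fact unit_mul1g : left_id unit_one unit_mul.
Proof. by move=> g; apply: uval_inj; rewrite /uval /= mul1r. Qed.
Fact unit_mulg1 : right_id unit_one unit_mul.
Proof. by move=> g; apply: uval_inj; rewrite /uval /= mulr1. Qed.
Fact unit_mulVg : left_inverse unit_one unit_inv unit_mul.
Proof. by move=> g; apply: uval_inj; rewrite /uval /= uvalVl. Qed.
Fact unit_mulgV : right_inverse unit_one unit_inv unit_mul.
Proof. by move=> g; apply: uval_inj; rewrite /uval /= uvalV. Qed.

HB.instance Definition _ := isGroup.Build inc_unit
  unit_mulA unit_mul1g unit_mulg1 unit_mulVg unit_mulgV.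

(* The embedding g |-> (g, g^-1) of the unit group as a closed subvariety of
   I(P) x I(P): the regular functions on G(P), and on its closed subvarieties,
   are the polynomials in these coordinates. *)
Definition unit_coord (g : inc_unit) : 'I_(inc_dim + inc_dim) -> k :=
  fun i => match split i with
           | inl j => inc_coord (uval g) j
           | inr j => inc_coord (uinv g) j
           end.

End IncidenceMonoid.

Arguments inc_dim {d} P.
Arguments uval {k d P} g.
Arguments uinv {k d P} g.

Section Tori.

Context (k : fieldType) {d : Order.disp_t} (P : finPOrderType d).
Local Notation G := (inc_unit k P).
Implicit Types T : G -> Prop.

Definition closed_subgroup T : Prop :=
  [/\ T 1%g,
      forall g h, T g -> T h -> T (g * h)%g,
      forall g, T g -> T (g^-1)%g &
      exists I : {mpoly k[inc_dim P]} -> Prop,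
        forall g, T g <-> forall p, I p -> p.@[inc_coord (uval g)] = 0].

Definition regular_on (A : Type) (n : nat) (c : A -> 'I_n -> k)
    (D : A -> Prop) (f : A -> k) : Prop :=
  exists p : {mpoly k[n]}, forall a, D a -> f a = p.@[c a].

(* The split torus G_m^r inside k^r, with regular functions the Laurent
   polynomials, i.e. the polynomials in the u_i and u_i^-1. *)
Definition in_Gm (r : nat) (u : {ffun 'I_r -> k}) : Prop :=
  forall i, u i != 0.

Definition Gm_coord (r : nat) (u : {ffun 'I_r -> k}) : 'I_(r + r) -> k :=
  fun i => match split i with
           | inl j => u j
           | inr j => (u j)^-1
           end.

(* phi : G_m^r -> T and psi : T -> G_m^r are mutually inverse isomorphisms of
   algebraic groups (the product of {ffun _ -> k} is pointwise). *)
Definition torus_iso T (r : nat)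
    (phi : {ffun 'I_r -> k} -> G) (psi : G -> {ffun 'I_r -> k}) : Prop :=
  [/\ [/\ forall u, in_Gm u -> T (phi u),
          forall g, T g -> in_Gm (psi g),
          forall u, in_Gm u -> psi (phi u) = u &
          forall g, T g -> phi (psi g) = g],
      forall u v, in_Gm u -> in_Gm v -> phi (u * v) = (phi u * phi v)%g,
      forall i, regular_on (@Gm_coord r) (@in_Gm r)
                  (fun u => inc_coord (uval (phi u)) i) &
      forall i, regular_on (@unit_coord k d P) T (fun g => psi g i)].

Definition is_torus T : Prop :=
  closed_subgroup T /\ exists r phi psi, @torus_iso T r phi psi.

Definition maximal_torus T : Prop :=
  is_torus T /\
  forall T', is_torus T' -> (forall g, T g -> T' g) -> forall g, T' g -> T g.

End Tori.

Section TranscendenceDegree.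

Context (F E : fieldType) (iota : F -> E).

Definition alg_indep (n : nat) (s : n.-tuple E) : Prop :=
  forall p : {mpoly F[n]}, mmap iota (tnth s) p = 0 -> p = 0.

(* A transcendence basis is a maximal algebraically independent family. *)
Definition transcendence_basis (K : E -> Prop) (n : nat) (s : n.-tuple E) :
    Prop :=
  [/\ forall i, K (tnth s i),
      alg_indep s &
      forall f, K f -> ~ alg_indep [tuple of f :: s]].

(* The subfield K of E has transcendence degree n over F. *)
Definition trdeg_eq (K : E -> Prop) (n : nat) : Prop :=
  exists s : n.-tuple E, transcendence_basis K s.

End TranscendenceDegree.

Section Complexity.

Context (k : fieldType) {d : Order.disp_t} (P : finPOrderType d).
Local Notation N := (inc_dim P).
Local Notation G := (inc_unit k P).
Local Notation "p %:F" := (FracField.tofrac p).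

Definition inc_act (s t : G) (x : incidence k P) : incidence k P :=
  uval s * x * uval (t^-1)%g.

Definition inc_basis (j : 'I_N) : incidence k P :=
  inc_of (fun i => (i == j)%:R).

Definition coact_coord (s t : G) (i : 'I_N) : {mpoly k[N]} :=
  \sum_(j < N) inc_coord (inc_act s t (inc_basis j)) i *: 'X_j.

(* The comorphism p |-> (x |-> p (s x t^-1)) of the coordinate ring, see
   coactE below. *)
Definition coact (s t : G) (p : {mpoly k[N]}) : {mpoly k[N]} :=
  p \mPo [tuple coact_coord s t i | i < N].

(* Its extension to the field k(I(P)) of rational functions, see rat_coactE
   below. *)
Definition rat_coact (s t : G) (f : {fraction {mpoly k[N]}}) :
    {fraction {mpoly k[N]}} :=
  (coact s t \n_(repr f))%:F / (coact s t \d_(repr f))%:F.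

Lemma inc_coord_sum (F : 'I_N -> incidence k P) i :
  inc_coord (\sum_j F j) i = \sum_j inc_coord (F j) i.
Proof.
rewrite /inc_coord; elim/big_rec2: _ => [|j a b _ <-]; first by rewrite ffunE.
by rewrite /= ffunE.
Qed.

Lemma inc_act_sum s t (F : 'I_N -> incidence k P) :
  inc_act s t (\sum_j F j) = \sum_j inc_act s t (F j).
Proof. by rewrite /inc_act mulr_sumr mulr_suml. Qed.

Definition inc_scale (a : k) (x : incidence k P) : incidence k P :=
  inc_of (fun i => a * inc_coord x i).

Lemma inc_scaleE a x u v : inc_scale a x (u, v) = a * x (u, v).
Proof.
rewrite ffunE; case: insubP => [q _ Eq|/inc_eq0 ->]; last by rewrite mulr0.
by rewrite /inc_coord enum_rankK Eq.
Qed.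

Lemma inc_scaleAl a x y : inc_scale a x * y = inc_scale a (x * y).
Proof.
apply/incP => u v; rewrite inc_scaleE !inc_convE mulr_sumr.
by apply: eq_bigr => z _; rewrite inc_scaleE mulrA.
Qed.

Lemma inc_scaleAr a x y : x * inc_scale a y = inc_scale a (x * y).
Proof.
apply/incP => u v; rewrite inc_scaleE !inc_convE mulr_sumr.
by apply: eq_bigr => z _; rewrite inc_scaleE mulrCA.
Qed.

Lemma inc_act_scale s t a x :
  inc_act s t (inc_scale a x) = inc_scale a (inc_act s t x).
Proof. by rewrite /inc_act inc_scaleAr inc_scaleAl. Qed.

Lemma inc_decomp (x : incidence k P) :
  x = \sum_j inc_scale (inc_coord x j) (inc_basis j).
Proof.
rewrite -[LHS]inc_coordK -[RHS]inc_coordK; apply/incP => u v; rewrite !ffunE.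
case: insubP => // q _ _; rewrite inc_coord_sum (bigD1 (enum_rank q)) //=.
rewrite inc_ofK inc_ofK eqxx mulr1 big1 ?addr0 // => j nj.
by rewrite !inc_ofK eq_sym (negPf nj) mulr0.
Qed.

Lemma coord_act s t x i :
  inc_coord (inc_act s t x) i =
    \sum_j inc_coord x j * inc_coord (inc_act s t (inc_basis j)) i.
Proof.
rewrite {1}(inc_decomp x) inc_act_sum inc_coord_sum.
by apply: eq_bigr => j _; rewrite inc_act_scale inc_ofK.
Qed.

Lemma coactE s t p x :
  (coact s t p).@[inc_coord x] = p.@[inc_coord (inc_act s t x)].
Proof.
rewrite comp_mpoly_meval; apply: meval_eq => i.
rewrite tnth_mktuple coord_act raddf_sum /=; apply: eq_bigr => j _.
by rewrite mevalZ mevalXU mulrC.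
Qed.

Lemma inc_actK s t x : inc_act s t (inc_act s^-1 t^-1 x)%g = x.
Proof.
rewrite /inc_act !mulrA uvalV mul1r -mulrA.
by rewrite (_ : uval (t^-1^-1)%g * _ = 1) ?mulr1 // uvalV.
Qed.

Lemma coactK s t : cancel (coact s t) (coact s^-1 t^-1)%g.
Proof.
move=> p; rewrite -[RHS](comp_mpoly_id p) /coact.
rewrite (comp_mpolyEX p (mktuple (fun i => coact_coord s t i))).
rewrite (comp_mpolyEX p (mktuple (fun i => 'X_i))).
rewrite (raddf_sum (comp_mpoly _)) /=; apply: eq_bigr => m _.
rewrite comp_mpolyZ; congr (_ *: _); rewrite !comp_mpolyX rmorph_prod /=.
apply: eq_bigr => i _; rewrite rmorphXn /= !tnth_mktuple; congr (_ ^+ _).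
rewrite raddf_sum /=.
transitivity (\sum_(l < N) inc_coord (inc_basis l) i *: 'X_l : {mpoly k[N]}).
  transitivity (\sum_(j < N) \sum_(l < N)
     (inc_coord (inc_act s^-1 t^-1 (inc_basis l))%g j *
      inc_coord (inc_act s t (inc_basis j)) i) *: 'X_l : {mpoly k[N]}).
    apply: eq_bigr => j _; rewrite comp_mpolyZ comp_mpolyXU -tnth_nth.
    rewrite tnth_mktuple scaler_sumr; apply: eq_bigr => l _.
    by rewrite scalerA mulrC.
  rewrite exchange_big /=; apply: eq_bigr => l _; rewrite -scaler_suml.
  by rewrite -coord_act inc_actK.
rewrite (bigD1 i) //= inc_ofK eqxx scale1r big1 ?addr0 // => l nl.
by rewrite inc_ofK eq_sym (negPf nl) scale0r.
Qed.

Lemma fracE (x : {ratio {mpoly k[N]}}) :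
  \pi_({fraction {mpoly k[N]}})%qT x = (\n_x)%:F / (\d_x)%:F.
Proof.
have nd := denom_ratioP x.
apply: (canRL (mulfK _)); rewrite ?tofrac_eq0 //.
unlock FracField.tofrac; rewrite -[LHS]FracField.pi_mul; apply/eqmodP.
rewrite /= FracField.equivfE /FracField.mulf !numden_Ratio ?oner_neq0 ?mulr1 //.
by rewrite mulrC.
Qed.

Lemma rat_coactE s t (p q : {mpoly k[N]}) : q != 0 ->
  rat_coact s t (p%:F / q%:F) = (coact s t p)%:F / (coact s t q)%:F.
Proof.
have coact_neq0 r : r != 0 -> coact s t r != 0.
  apply: contra_neq => E; rewrite -[LHS](coactK s t) E.
  by rewrite /coact raddf0.
move=> nq; rewrite /rat_coact; set f := p%:F / q%:F.
have nd := denom_ratioP (repr f).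
have Ef : f = (\n_(repr f))%:F / (\d_(repr f))%:F by rewrite -fracE reprK.
have : p * \d_(repr f) = \n_(repr f) * q.
  apply/eqP; rewrite -(tofrac_eq (p * _)) !tofracM.
  rewrite -eqr_div ?tofrac_eq0 //; first exact/eqP.
move=> /(congr1 (coact s t)); rewrite /coact !rmorphM /= => E.
apply/esym/eqP; rewrite eqr_div ?tofrac_eq0 ?coact_neq0 //.
by rewrite -!tofracM tofrac_eq E.
Qed.

Definition invariant (T : G -> Prop) (f : {fraction {mpoly k[N]}}) : Prop :=
  forall s t, T s -> T t -> rat_coact s t f = f.

Definition complexity_eq (T : G -> Prop) (c : nat) : Prop :=
  trdeg_eq (fun a : k => (a%:MP_[N])%:F) (invariant T) c.

End Complexity.

Section ZetaPolynomial.

Context {d : Order.disp_t} (P : finPOrderType d).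

Lemma zeta_poly_uniq (Z Z' : {poly rat}) :
  is_zeta_poly P Z -> is_zeta_poly P Z' -> Z = Z'.
Proof.
move=> HZ HZ'; apply/eqP; rewrite -subr_eq0; apply/eqP.
pose rs := [seq n.+2%:R : rat | n <- iota 0 (size (Z - Z'))].
apply: (@roots_geq_poly_eq0 _ _ rs).
- apply/allP => _ /mapP[n _ ->]; apply/rootP.
  by rewrite hornerD hornerN HZ // HZ' // subrr.
- rewrite map_inj_uniq ?iota_uniq // => m n /eqP.
  by rewrite eqr_nat => /eqP[].
- by rewrite size_map size_iota.
Qed.

Lemma big_tuple_cons (m : nat) (F : m.+1.-tuple P -> rat) :
  \sum_t F t = \sum_z \sum_(t : m.-tuple P) F [tuple of z :: t].
Proof.
rewrite pair_bigA /= (reindex (fun u : P * m.-tuple P => [tuple of u.1 :: u.2])).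
  by apply: eq_bigr => -[].
exists (fun t => (thead t, [tuple of behead t])) => [[z t]|t] _ /=.
  by congr pair; apply: val_inj.
by rewrite [RHS]tuple_eta.
Qed.

Let zeta_fun : {ffun P * P -> rat} := [ffun p => (p.1 <= p.2)%O%:R].
Fact zeta_subproof : le_supported zeta_fun.
Proof. by apply/le_supportedP => x y /negPf nxy; rewrite ffunE /= nxy. Qed.
Let zeta : incidence rat P := Incidence zeta_subproof.

Lemma count_paths m x :
  \sum_(t : m.-tuple P) (path <=%O x t)%:R = \sum_y (zeta ^+ m) (x, y).
Proof.
elim: m x => [|m IH] x.
  rewrite (big_pred1 [tuple]) => [|t]; last by rewrite [t]tuple0 /= eqxx.
  rewrite expr0 (bigD1 x) //= ffunE eqxx big1 ?addr0 // => y nyx.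
  by rewrite ffunE /= eq_sym (negPf nyx).
rewrite big_tuple_cons.
under [RHS]eq_bigr => y _ do rewrite exprS inc_convE.
rewrite [RHS]exchange_big /=; apply: eq_bigr => z _.
rewrite -mulr_sumr -IH mulr_sumr; apply: eq_bigr => t _.
by rewrite ffunE /= -natrM mulnb.
Qed.

Lemma card_multichains m :
  #|multichains P m.+1|%:R = \sum_x \sum_y (zeta ^+ m) (x, y) :> rat.
Proof.
rewrite cardsE -sum1_card natr_sum big_mkcond big_tuple_cons /=.
apply: eq_bigr => x _; rewrite -count_paths; apply: eq_bigr => t _.
by rewrite unfold_in /=; case: ifP.
Qed.

Lemma zeta_sub1_nilp i x y :
  ((zeta - 1) ^+ i) (x, y) != 0 -> (i <= #|[pred z | (z < y)%O]|)%N.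
Proof.
elim: i y => // i IH y; rewrite exprSr inc_convE => nz.
have [z] : exists z, ((zeta - 1) ^+ i) (x, z) * (zeta - 1) (z, y) != 0.
  apply/existsP; apply: contraNT nz => /existsPn h.
  by rewrite big1 // => z _; apply/eqP; have := h z; rewrite negbK.
rewrite mulf_eq0 negb_or => /andP[/IH le_i].
have -> : (zeta - 1) (z, y) = (z < y)%O%:R.
  rewrite [LHS]ffunE ffunE [X in _ + X]ffunE ffunE /= lt_neqAle.
  by have [->|] := eqVneq z y; rewrite ?lexx ?subrr ?subr0.
case: (boolP (z < y)%O) => // lt_zy _; apply: (leq_ltn_trans le_i).
apply: proper_card; apply/properP; split.
  by apply/subsetP => w; rewrite !inE => /lt_trans; apply.
by exists z; rewrite !inE ?ltxx.
Qed.

Lemma zeta_poly_exists : exists Z, is_zeta_poly P Z.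
Proof.
pose c i := \sum_x \sum_y ((zeta - 1) ^+ i) (x, y).
pose b i : {poly rat} := i`!%:R^-1 *: \prod_(j < i) ('X - (j.+2)%:R%:P).
have bE i m : (b i).[m.+2%:R] = 'C(m, i)%:R.
  rewrite hornerZ horner_prod.
  have -> : \prod_(j < i) ('X - (j.+2)%:R%:P).[m.+2%:R] = (m ^_ i)%:R :> rat.
    elim: i => [|i IH]; first by rewrite big_ord0.
    rewrite big_ord_recr IH ffactnSr natrM /=.
    rewrite hornerD hornerX hornerN hornerC -!natr1 !opprD !addrA.
    case: (leqP i m) => [im|mi]; last by rewrite ffact_small // !mul0r.
    by congr (_ * _); rewrite natrB //; ring.
  by rewrite -bin_ffact natrM mulrC mulfK // pnatr_eq0 -lt0n fact_gt0.
have c0 i : (#|P| <= i)%N -> c i = 0.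
  move=> le_Pi; apply: big1 => x _; apply: big1 => y _; apply/eqP.
  apply: contraTT le_Pi => /zeta_sub1_nilp le_i; rewrite -ltnNge.
  apply: (leq_ltn_trans le_i); apply: proper_card; apply/properP; split.
    exact/subsetP.
  by exists y; rewrite !inE ?ltxx.
have widen (F : nat -> rat) n e :
    (forall i, (n <= i)%N -> F i = 0) -> \sum_(i < n) F i = \sum_(i < n + e) F i.
  move=> F0; rewrite big_split_ord /= [X in _ + X]big1 ?addr0 // => i _.
  by rewrite F0 // leq_addr.
exists (\sum_(i < #|P|) c i *: b i) => -[|[|m]] // _.
rewrite card_multichains horner_sum; symmetry.
transitivity (\sum_(i < m.+1) c i * 'C(m, i)%:R); last first.
  pose F i := c i * 'C(m, i)%:R.
  have E1 : \sum_(i < #|P|) F i = \sum_(i < #|P| + m.+1) F i.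
    by apply: widen => i /c0 ci0; rewrite /F ci0 mul0r.
  have E2 : \sum_(i < m.+1) F i = \sum_(i < m.+1 + #|P|) F i.
    by apply: widen => i lt_mi; rewrite /F bin_small ?mulr0.
  transitivity (\sum_(i < #|P|) F i); last first.
    by apply: eq_bigr => i _; rewrite hornerZ bE.
  by rewrite E1 addnC -E2.
rewrite -[zeta in LHS](subrK 1).
have -> : \sum_(i < m.+1) c i * 'C(m, i)%:R =
    \sum_x \sum_y \sum_(i < m.+1) ((zeta - 1) ^+ i) (x, y) * 'C(m, i)%:R.
  under eq_bigr => i _ do rewrite /c mulr_suml.
  rewrite exchange_big; apply: eq_bigr => x _ /=.
  under eq_bigr => i _ do rewrite mulr_suml.
  by rewrite exchange_big.
apply: eq_bigr => x _; apply: eq_bigr => y _.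
have sumE n (F : 'I_n -> incidence rat P) u :
    (\sum_i F i) u = \sum_i F i u.
  by elim/big_rec2: _ => [|i ? ? _ <-]; rewrite [LHS]ffunE.
rewrite exprD1n sumE; apply: eq_bigr => i _.
elim: ('C(m, i)) => [|n IH]; first by rewrite mulr0n mulr0 ffunE.
by rewrite mulrS inc_addE IH -natr1 mulrDr mulr1 addrC.
Qed.

End ZetaPolynomial.

(* Main.v *)
Require Import Defs.
From mathcomp Require Import all_boot all_order all_algebra.
From mathcomp Require Import mpoly ring.

(* Expanding a parametrization u |-> phi u of T in characters of G_m^r gives
   phi u = sum_a u^a A_a, where Dedekind independence and multiplicativity make
   the A_a orthogonal idempotents of I(P) with sum 1; the unitriangular element
   sum_a A_a diag(A_a) conjugates them to diagonal ones. So T lies in, hence by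
   maximality equals, a conjugate g D g^-1 of the group D of diagonal units.

   In the coordinates of g^-1 x g the action is x_(a,b) |-> s_a x_(a,b) / t_b,
   a rescaling of the edges of the bipartite graph on P + P with an edge
   inl a -- inr b for each a <= b. This graph is connected when P is; fix a
   spanning tree, which has 2 #|P| - 1 edges. Each edge e outside the tree closes
   a cycle, whose Laurent monomial M_e is invariant. The M_e are algebraically
   independent because each contains its own variable x_e. Conversely the torus
   moves a generic point x to one whose tree coordinates are fixed constants and
   whose other coordinates are multiples of M_e(x), so an invariant p / q
   satisfies the nontrivial relation f * q(M) = p(M). *)

Set Implicit Arguments.
Unset Strict Implicit.
Unset Printing Implicit Defensive.

Import Order.TTheory GRing.Theory.
Local Open Scope ring_scope.

(** * Laurent monomials over a field *)

Section LaurentMonomials.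

Context (F : fieldType) (n : nat).
Implicit Types (a b : {ffun 'I_n -> int}) (x y : 'I_n -> F).

(** At nowhere zero points this is the character of weight [a]. [F] is arbitrary because such
    monomials are formed both over [k] and in the field of rational functions. *)
Definition lmon a x : F := \prod_j x j ^ a j.

Definition unit_exp (j : 'I_n) : {ffun 'I_n -> int} := [ffun i => (i == j)%:R].

Lemma lmon_neq0 a x : (forall j, x j != 0) -> lmon a x != 0.
Proof. by move=> x0; apply/prodf_neq0 => j _; rewrite expfz_neq0. Qed.

Lemma lmonD a b x :
  (forall j, x j != 0) -> lmon (a + b) x = lmon a x * lmon b x.
Proof.
move=> x0; rewrite -big_split; apply: eq_bigr => j _.
by rewrite ffunE expfzDr.
Qed.

Lemma lmonN a x : lmon (- a) x = (lmon a x)^-1.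
Proof. by rewrite -prodfV; apply: eq_bigr => j _; rewrite ffunE -invr_expz. Qed.

Lemma lmonB a b x :
  (forall j, x j != 0) -> lmon (a - b) x = lmon a x / lmon b x.
Proof. by move=> x0; rewrite lmonD // lmonN. Qed.

Lemma lmon0 x : lmon 0 x = 1.
Proof. by apply: big1 => j _; rewrite ffunE expr0z. Qed.

Lemma lmon1 a : lmon a (fun=> 1) = 1.
Proof. by apply: big1 => j _; rewrite exp1rz. Qed.

Lemma lmon_unit_exp j x : lmon (unit_exp j) x = x j.
Proof.
rewrite /lmon (bigD1 j) //= ffunE eqxx expr1z big1 ?mulr1 // => i nij.
by rewrite ffunE (negPf nij) expr0z.
Qed.

Lemma lmonM a x y : lmon a (fun j => x j * y j) = lmon a x * lmon a y.
Proof. by rewrite -big_split; apply: eq_bigr => j _; rewrite expfzMl. Qed.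

Lemma eq_lmon a x y : x =1 y -> lmon a x = lmon a y.
Proof. by move=> xy; apply: eq_bigr => j _; rewrite xy. Qed.

End LaurentMonomials.

(** * Independence of characters over an algebraically closed field *)

Section Characters.

Context (k : closedFieldType).

(** An algebraically closed field is infinite, so $X(X^{|e|}-1)$ has a nonroot; the factor $X$ keeps
    it away from zero. *)
Lemma exp_nontrivial (e : int) : e != 0 -> exists2 c : k, c != 0 & c ^ e != 1.
Proof.
move=> e0; have n0 : (0 < `|e|)%N by rewrite absz_gt0.
have p0 : ('X * ('X^(`|e|%N) - 1%:P) : {poly k}) != 0.
  by rewrite mulf_neq0 ?polyX_eq0 // -size_poly_eq0 size_XnsubC.
have [c] := closed_nonrootP _ p0.
rewrite rootM negb_or !rootE hornerX !hornerE subr_eq0 => /andP[c0 c1].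
exists c => //; case: (intP e) n0 c1 e0 => [|m|m] //= _.
by rewrite -invr_expz invr_eq1.
Qed.

Context (n : nat).
Implicit Types a b : {ffun 'I_n -> int}.

Lemma lmon_separates a b : a != b ->
  exists2 v : 'I_n -> k, (forall j, v j != 0) & lmon a v != lmon b v.
Proof.
move=> nab; have [j nj] : exists j, a j != b j.
  apply/existsP; apply: contraNT nab => /existsPn h.
  by apply/eqP/ffunP => j; apply/eqP; have := h j; rewrite negbK.
have [c c0 c1] : exists2 c : k, c != 0 & c ^ (a j - b j) != 1.
  by apply: exp_nontrivial; rewrite subr_eq0.
pose v i : k := if i == j then c else 1.
have v0 i : v i != 0 by rewrite /v; case: ifP; rewrite ?oner_neq0.
have E e : lmon e v = c ^ e j.
  rewrite /lmon (bigD1 j) //= /v eqxx big1 ?mulr1 // => i /negPf ->.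
  by rewrite exp1rz.
exists v => //; rewrite !E; apply: contraNneq c1 => E1.
by rewrite expfzDr // E1 -expfzDr // subrr.
Qed.

(* Dedekind: if a relation holds at u and at u * v, then subtracting
   [lmon b v] times the first from the second eliminates the character b. *)
Lemma lmon_free (S : seq {ffun 'I_n -> int}) (c : {ffun 'I_n -> int} -> k) :
    uniq S ->
    (forall u : 'I_n -> k, (forall j, u j != 0) ->
       \sum_(a <- S) c a * lmon a u = 0) ->
  forall a, a \in S -> c a = 0.
Proof.
elim: S c => [|b S IH] c //= /andP[bS uS] rel.
have cS a : a \in S -> c a = 0.
  move=> aS; have nab : a != b by apply: contraNneq bS => <-.
  have [v v0 nv] := lmon_separates nab.
  have : c a * (lmon a v - lmon b v) = 0.
    apply: (IH (fun a => c a * (lmon a v - lmon b v))) => // u u0.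
    have := rel (fun j => u j * v j); rewrite big_cons.
    move=> /(_ (fun j => mulf_neq0 (u0 j) (v0 j))).
    have := rel u u0; rewrite big_cons => /(canRL (addrK _)); rewrite sub0r.
    rewrite lmonM mulrA => -> /eqP; rewrite addrC mulNr subr_eq0 => /eqP E.
    under eq_bigr => a' _ do rewrite mulrAC mulrBr.
    rewrite sumrB -mulr_suml -E; apply/eqP; rewrite subr_eq0; apply/eqP.
    by apply: eq_bigr => a' _; rewrite lmonM mulrA.
  by move=> /eqP; rewrite mulf_eq0 subr_eq0 (negPf nv) orbF => /eqP.
move=> a; rewrite inE => /predU1P[->|/cS //].
(* The other coefficients vanish by now, so the relation at $u=1$ reads off that of [b]. *)
have := rel (fun=> 1) (fun=> oner_neq0 _); rewrite big_cons big_seq big1.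
  by rewrite addr0 lmon1 mulr1.
by move=> a' a'S; rewrite cS // mul0r.
Qed.

Definition expz_of (m : 'X_{1..n}) : {ffun 'I_n -> int} := [ffun i => Posz (m i)].

Lemma expz_of_inj : injective expz_of.
Proof.
by move=> m m' /ffunP E; apply/mnmP => i; have := E i; rewrite !ffunE => -[].
Qed.

Lemma lmon_expz_of m (v : 'I_n -> k) : lmon (expz_of m) v = \prod_i v i ^+ m i.
Proof. by apply: eq_bigr => i _; rewrite ffunE -exprnP. Qed.

(** The torus is Zariski dense: distinct monomials restrict to distinct characters, and these are
    independent by [lmon_free]. *)
Lemma mpoly_eq0_torus (p : {mpoly k[n]}) :
  (forall v, (forall j, v j != 0) -> p.@[v] = 0) -> p = 0.
Proof.
move=> p0; pose c a := \sum_(m <- msupp p | expz_of m == a) p@_m.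
have cE m : m \in msupp p -> c (expz_of m) = p@_m.
  move=> mp; rewrite /c -big_filter (_ : [seq _ <- _ | _] = [:: m]) ?big_seq1 //.
  rewrite -(filter_pred1_uniq (msupp_uniq p) mp); apply: eq_filter => m' /=.
  by rewrite (inj_eq expz_of_inj).
have c0 : forall a, a \in map expz_of (msupp p) -> c a = 0.
  apply: lmon_free; first by rewrite map_inj_uniq ?msupp_uniq //; apply: expz_of_inj.
  move=> u u0; rewrite -[RHS](p0 u u0) mevalE big_map !big_seq.
  by apply: eq_bigr => m mp; rewrite cE // lmon_expz_of.
apply/mpolyP => m; rewrite mcoeff0; case: (boolP (m \in msupp p)) => [mp|].
  by rewrite -cE // c0 // map_f.
by move/memN_msupp_eq0.
Qed.


End Characters.

(** * Diagonal and unitriangular elements of the incidence algebra *)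

Section IncidenceAlgebra.

Context (k : fieldType) {d : Order.disp_t} (P : finPOrderType d).
Local Notation I := (incidence k P).
Implicit Types a b : I.

Definition inc_index x y (le_xy : (x <= y)%O) : 'I_(inc_dim P) :=
  enum_rank (Sub (x, y) le_xy
             : Defs.interval P).

Lemma val_inc_index x y (le_xy : (x <= y)%O) :
  val (enum_val (inc_index le_xy)) = (x, y).
Proof. by rewrite enum_rankK. Qed.

Lemma inc_coord_index a x y (le_xy : (x <= y)%O) :
  inc_coord a (inc_index le_xy) = a (x, y).
Proof. by rewrite /inc_coord val_inc_index. Qed.

Lemma inc_coord_inj a b : inc_coord a =1 inc_coord b -> a = b.
Proof.
move=> E; rewrite -[LHS]inc_coordK -[RHS]inc_coordK.
apply/incP => x y; rewrite !ffunE; case: insubP => // q _ _; exact: E.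
Qed.

Lemma inc_sumE J (r : seq J) (F : J -> I) u :
  (\sum_(j <- r) F j) u = \sum_(j <- r) F j u.
Proof. by elim/big_rec2: _ => [|j ? ? _ <-]; rewrite [LHS]ffunE. Qed.

Lemma inc_oneE x y : (1 : I) (x, y) = (x == y)%:R.
Proof. by rewrite ffunE. Qed.

Lemma inc_mul_diag a b x : (a * b) (x, x) = a (x, x) * b (x, x).
Proof.
rewrite inc_mulE (big_pred1 x) // => z /=.
by rewrite eq_le andbC.
Qed.

(** Every factor [a] contributes a strict step, so a nonzero entry of the power yields a chain of
    [i] elements strictly below [y]. *)
Lemma strict_exp_support a i x y : (forall z, a (z, z) = 0) ->
  (a ^+ i) (x, y) != 0 -> (i <= #|[pred z | (z < y)%O]|)%N.
Proof.
move=> a0; elim: i y => // i IH y; rewrite exprSr inc_convE => nz.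
have [z] : exists z, (a ^+ i) (x, z) * a (z, y) != 0.
  apply/existsP; apply: contraNT nz => /existsPn h.
  by rewrite big1 // => z _; apply/eqP; have := h z; rewrite negbK.
rewrite mulf_eq0 negb_or => /andP[/IH le_i azy].
have lt_zy : (z < y)%O.
  rewrite lt_neqAle; apply/andP; split.
    by apply: contraNneq azy => ->; rewrite a0.
  by apply: contraNT azy => /inc_eq0 ->.
apply: (leq_ltn_trans le_i); apply: proper_card; apply/properP; split.
  by apply/subsetP => w; rewrite !inE => /lt_trans; apply.
by exists z; rewrite !inE ?ltxx.
Qed.

Lemma strict_nilpotent a : (forall z, a (z, z) = 0) -> a ^+ #|P| = 0.
Proof.
move=> a0; apply/incP => x y; rewrite [RHS]ffunE; apply/eqP.
apply: contraT => /(strict_exp_support a0); rewrite leqNgt => /negP[].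
apply: proper_card; apply/properP; split; first exact/subsetP.
by exists y; rewrite !inE ?ltxx.
Qed.

(** The inverse is the geometric series in the nilpotent element [1 - a]. *)
Lemma unitriangular_unit a :
  (forall x, a (x, x) = 1) -> exists g : inc_unit k P, uval g = a.
Proof.
move=> a1; pose n := 1 - a; pose b : I := \sum_(i < #|P|) n ^+ i.
have nN : n ^+ #|P| = 0.
  by apply: strict_nilpotent => z; rewrite inc_addE inc_oneE eqxx ffunE a1 subrr.
have Ea : a = 1 - n by rewrite /n subKr.
have ab : a * b = 1.
  apply: oppr_inj; rewrite -mulNr Ea opprB -subrX1 nN sub0r //.
have ba : b * a = 1.
  rewrite -ab; apply/esym/commr_sum => i _; apply: commrX.
  by rewrite Ea; apply: commr_sym; apply: commrB; [apply: commr1|].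
have abP : ((a, b).1 * (a, b).2 == 1) && ((a, b).2 * (a, b).1 == 1).
  by rewrite /= ab ba eqxx.
by exists (IncUnit abP).
Qed.

Definition inc_diag (u : P -> k) : I :=
  inc_of (fun i => let p := val (enum_val i) in if p.1 == p.2 then u p.1 else 0).

Lemma inc_diagE u x y : inc_diag u (x, y) = if x == y then u x else 0.
Proof.
rewrite ffunE; case: insubP => [q _ /= Eq|]; first by rewrite enum_rankK Eq.
by case: eqP => // ->; rewrite lexx.
Qed.

Lemma inc_diag_mull u a x y : (inc_diag u * a) (x, y) = u x * a (x, y).
Proof.
rewrite inc_convE (bigD1 x) //= inc_diagE eqxx big1 ?addr0 // => z nz.
by rewrite inc_diagE eq_sym (negPf nz) mul0r.
Qed.

Lemma inc_diag_mulr u a x y : (a * inc_diag u) (x, y) = a (x, y) * u y.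
Proof.
rewrite inc_convE (bigD1 y) //= inc_diagE eqxx big1 ?addr0 // => z nz.
by rewrite inc_diagE (negPf nz) mulr0.
Qed.

Lemma inc_diagM u v : inc_diag u * inc_diag v = inc_diag (fun x => u x * v x).
Proof.
apply/incP => x y; rewrite inc_diag_mull !inc_diagE.
by case: eqP => [->|_]; rewrite ?mulr0.
Qed.

Lemma inc_diag1 u : u =1 (fun=> 1) -> inc_diag u = 1.
Proof.
by move=> u1; apply/incP => x y; rewrite inc_diagE inc_oneE u1; case: eqP.
Qed.

Lemma is_inc_diag a :
  (forall x y, x != y -> a (x, y) = 0) -> a = inc_diag (fun x => a (x, x)).
Proof.
move=> a0; apply/incP => x y; rewrite inc_diagE.
by case: eqVneq => [->//|/a0].
Qed.

Lemma uval_diag_neq0 (g : inc_unit k P) x : uval g (x, x) != 0.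
Proof.
have := inc_mul_diag (uval g) (uinv g) x; rewrite uvalV inc_oneE eqxx => E.
by apply: contra_eq_neq E => ->; rewrite mul0r oner_neq0.
Qed.

Lemma uinv_diagE (g : inc_unit k P) x : uinv g (x, x) = (uval g (x, x))^-1.
Proof.
have := inc_mul_diag (uval g) (uinv g) x; rewrite uvalV inc_oneE eqxx.
by move/esym/(canRL (mulKf (uval_diag_neq0 g x))) ->; rewrite mulr1.
Qed.

End IncidenceAlgebra.

(** * Conjugates of the diagonal group are tori *)

Section DiagonalTorus.

Context (k : fieldType) {d : Order.disp_t} (P : finPOrderType d).
Local Notation G := (inc_unit k P).
Local Notation N := (inc_dim P).
Implicit Types (g h : G).

(* h lies in the conjugate g D g^-1 of the group D of diagonal units. *)
Definition conj_diag g h : Prop :=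
  forall x y, x != y -> inc_act g^-1%g g^-1%g (uval h) (x, y) = 0.

Lemma conj_actE g (a : incidence k P) : inc_act g^-1%g g^-1%g a = uinv g * a * uval g.
Proof. by []. Qed.

(** Taking a diagonal entry is multiplicative, so the factors from [g] cancel. The diagonal form of
    a conjugated unit can thus be read off the unit itself. *)
Lemma conj_act_diag g (a : incidence k P) x :
  inc_act g^-1%g g^-1%g a (x, x) = a (x, x).
Proof.
rewrite conj_actE !inc_mul_diag uinv_diagE mulrAC mulVf ?mul1r //.
exact: uval_diag_neq0.
Qed.

Lemma conj_diagP g h : conj_diag g h ->
  uinv g * uval h * uval g = inc_diag (fun x => uval h (x, x)).
Proof.
move=> gh; rewrite -conj_actE [LHS]is_inc_diag //; apply/incP => x y.
by rewrite !inc_diagE conj_act_diag.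
Qed.

Lemma conj_diagI g h u :
  uval h = uval g * inc_diag u * uinv g -> conj_diag g h.
Proof.
move=> E x y nxy; rewrite conj_actE E !mulrA uvalVl mul1r -mulrA uvalVl mulr1.
by rewrite inc_diagE (negPf nxy).
Qed.

Lemma conj_diagE g h : conj_diag g h ->
  uval h = uval g * inc_diag (fun x => uval h (x, x)) * uinv g.
Proof.
move=> /conj_diagP <-; rewrite !mulrA uvalV mul1r -mulrA uvalV mulr1 //.
Qed.

(** The two sides are a left and a right inverse of the same diagonal element. *)
Lemma conj_diag_inv g h : conj_diag g h ->
  uinv g * uinv h * uval g = inc_diag (fun x => uinv h (x, x)).
Proof.
move=> gh; set a := LHS; pose e := inc_diag (fun x => uval h (x, x)).
have ae : e * inc_diag (fun x => uinv h (x, x)) = 1.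
  rewrite inc_diagM; apply: inc_diag1 => x.
  by rewrite -inc_mul_diag uvalV inc_oneE eqxx.
suff ae1 : a * e = 1 by rewrite -[LHS]mulr1 -ae mulrA ae1 mul1r.
rewrite /e -(conj_diagP gh) /a.
rewrite -!mulrA (mulrA (uval g)) uvalV mul1r (mulrA (uinv h)) uvalVl mul1r.
exact: uvalVl.
Qed.

(** The default value, the identity, is taken when [u] vanishes somewhere. *)
Definition diag_unit (u : P -> k) : G :=
  insubd (@unit_one k d P) (inc_diag u, inc_diag (fun x => (u x)^-1)).

Lemma diag_unitE u : (forall x, u x != 0) -> uval (diag_unit u) = inc_diag u.
Proof.
move=> u0; rewrite /uval /diag_unit /insubd insubT //=.
by rewrite !inc_diagM !inc_diag1 ?eqxx // => x; rewrite ?mulfV ?mulVf.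
Qed.

Lemma conj_diag_torus g : is_torus (conj_diag g).
Proof.
split.
  split.
  - by apply: (@conj_diagI _ _ (fun=> 1)); rewrite inc_diag1 // mulr1 uvalV.
  - move=> h h' /conj_diagE E /conj_diagE E'.
    apply: conj_diagI; rewrite -[uval _]/(uval h * uval h') E E' !mulrA.
    by rewrite -(mulrA _ (uinv g) (uval g)) uvalVl mulr1 -(mulrA (uval g)) inc_diagM.
  - move=> h /conj_diag_inv E; apply: (conj_diagI (u := fun x => uinv h (x, x))).
    by rewrite -E !mulrA uvalV mul1r -mulrA uvalV mulr1.
  (* The equations are the off-diagonal coordinates of $g^{-1}hg$, pulled back to functions of
     $h$. *)
  exists (fun p => exists2 i : 'I_N, (val (enum_val i)).1 != (val (enum_val i)).2
                                   & p = coact g^-1 g^-1 'X_i)%g.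
  move=> h; split=> [Th _ [i ni ->]|h0 x y nxy].
    rewrite coactE mevalXU /inc_coord; case: (val _) ni => x y /= nxy.
    exact: Th.
  case: (boolP (x <= y)%O) => [le_xy|/inc_eq0 //].
  have := h0 _ (ex_intro2 _ _ (inc_index le_xy) _ erefl).
  by rewrite coactE mevalXU inc_coord_index val_inc_index; apply.
pose dg (u : {ffun 'I_#|P| -> k}) : G := diag_unit (fun x => u (enum_rank x)).
pose ii (j : 'I_#|P|) : 'I_N :=
  inc_index (lexx (enum_val j)).
have iiE (a : incidence k P) j : inc_coord a (ii j) = a (enum_val j, enum_val j).
  exact: inc_coord_index.
have dgE u : in_Gm u -> uval (dg u) = inc_diag (fun x => u (enum_rank x)).
  by move=> u0; apply: diag_unitE.
exists #|P|, (fun u => g * dg u * g^-1)%g,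
  (fun h => [ffun j => uval h (enum_val j, enum_val j)]).
have phiE u : in_Gm u -> uval (g * dg u * g^-1)%g =
    uval g * inc_diag (fun x => u (enum_rank x)) * uinv g.
  by move=> u0; rewrite -dgE.
have phi_diag u x : in_Gm u -> uval (g * dg u * g^-1)%g (x, x) = u (enum_rank x).
  move=> u0; rewrite phiE // !inc_mul_diag inc_diagE eqxx uinv_diagE mulrAC.
  by rewrite mulfV ?mul1r // uval_diag_neq0.
split.
- split.
  + by move=> u /phiE; apply: conj_diagI.
  + by move=> h _ j; rewrite ffunE uval_diag_neq0.
  + by move=> u u0; apply/ffunP => j; rewrite ffunE phi_diag // enum_valK.
  + move=> h /conj_diagE Eh; apply: uval_inj; rewrite phiE => [|j]; last first.
      by rewrite ffunE uval_diag_neq0.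
    rewrite [RHS]Eh; congr (_ * _ * _); apply/incP => x y.
    by rewrite !inc_diagE ffunE enum_rankK.
- move=> u v u0 v0; apply: uval_inj.
  have uv0 : in_Gm (u * v) by move=> j; rewrite ffunE mulf_neq0.
  rewrite phiE //; apply/esym.
  rewrite -[LHS]/(uval (g * dg u * g^-1)%g * uval (g * dg v * g^-1)%g) !phiE //.
  rewrite !mulrA -(mulrA _ (uinv g) (uval g)) uvalVl mulr1 -(mulrA (uval g)).
  rewrite inc_diagM; congr (_ * _ * _); apply/incP => x y.
  by rewrite !inc_diagE ffunE.
(* A diagonal element is a linear combination of the diagonal idempotents with coefficients $u_j$,
   so each entry of its conjugate is linear in $u$. *)
- move=> i; exists (\sum_(j < #|P|)
      ((uval g * inc_diag (fun x => (x == enum_val j)%:R) * uinv g)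
         (val (enum_val i))) *: 'X_(lshift #|P| j)) => u u0.
  rewrite /inc_coord phiE //.
  pose M (j : 'I_#|P|) :=
    uval g * inc_diag (fun x => (x == enum_val j)%:R) * uinv g.
  transitivity (\sum_j M j (val (enum_val i)) * u j); last first.
    rewrite raddf_sum /=; apply: eq_bigr => j _.
    by rewrite mevalZ mevalXU /Gm_coord (unsplitK (inl _)).
  case: (val (enum_val i)) => x y; rewrite inc_convE.
  under [RHS]eq_bigr => j _ do rewrite /M inc_convE mulr_suml.
  rewrite exchange_big; apply: eq_bigr => z _.
  rewrite inc_diag_mulr.
  under eq_bigr => j _ do rewrite inc_diag_mulr.
  rewrite (bigD1 (enum_rank z)) //= enum_rankK eqxx mulr1 big1 ?addr0 => [|j nj].
    by rewrite mulrAC.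
  rewrite (_ : z == _ = false) ?mulr0 ?mul0r //.
  by apply: contraNF nj => /eqP ->; rewrite enum_valK.
- move=> j; exists 'X_(lshift N (ii j)) => h _.
  by rewrite mevalXU ffunE /unit_coord (unsplitK (inl _)) iiE.
Qed.

End DiagonalTorus.

(** * Every torus is conjugate into the diagonal group *)

Section ToriAreDiagonalizable.

Context (k : closedFieldType) {d : Order.disp_t} (P : finPOrderType d).
Local Notation G := (inc_unit k P).
Local Notation I := (incidence k P).
Local Notation N := (inc_dim P).

(* phi(uv) = phi(u) phi(v), expanded in characters, forces the coefficients
   to be orthogonal idempotents. *)
Lemma torus_idempotents (T : G -> Prop) r phi psi :
    @torus_iso k d P T r phi psi ->
  exists (S : seq {ffun 'I_r -> int}) (A : {ffun 'I_r -> int} -> I),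
    [/\ uniq S,
        forall u, in_Gm u -> forall x y,
          uval (phi u) (x, y) = \sum_(a <- S) lmon a u * A a (x, y),
        forall a b, a \in S -> b \in S -> A a * A b = if a == b then A a else 0 &
        \sum_(a <- S) A a = 1].
Proof.
case=> -[_ _ _ _] phiM /fin_all_exists[p phip] _.
(* The first [r] variables stand for the $u_j$ and the last [r] for their inverses, so a monomial
   restricts to the character whose weight is the difference of the exponents. *)
pose e (m : 'X_{1..r + r}) : {ffun 'I_r -> int} :=
  [ffun j => Posz (m (lshift r j)) - Posz (m (rshift r j))].
have eE (m : 'X_{1..r + r}) (u : {ffun 'I_r -> k}) : in_Gm u -> \prod_l Gm_coord u l ^+ m l = lmon (e m) u.
  move=> u0; rewrite big_split_ord /= -big_split; apply: eq_bigr => j _.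
  rewrite /Gm_coord (unsplitK (inl _)) (unsplitK (inr _)) ffunE expfzDr //.
  by rewrite exprVn -exprnN -exprnP.
pose S := undup (flatten [seq map e (msupp (p i)) | i <- enum 'I_N]).
pose A a : I := inc_of (fun i => \sum_(m <- msupp (p i) | e m == a) (p i)@_m).
have phiE (u : {ffun 'I_r -> k}) : in_Gm u -> forall x y,
    uval (phi u) (x, y) = \sum_(a <- S) lmon a u * A a (x, y).
  move=> u0 x y; case: (boolP (x <= y)%O) => [le_xy|n_xy]; last first.
    by rewrite inc_eq0 // big1 // => a _; rewrite inc_eq0 // mulr0.
  rewrite -(inc_coord_index _ le_xy) phip // mevalE; set i := inc_index _.
  under [RHS]eq_bigr => a _ do
    rewrite -(inc_coord_index _ le_xy) inc_ofK mulr_sumr big_mkcond.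
  rewrite exchange_big !big_seq; apply: eq_bigr => m mp.
  have emS : e m \in S.
    by rewrite mem_undup; apply/flatten_mapP; exists i; rewrite ?mem_enum ?map_f.
  rewrite (bigD1_seq (e m)) ?undup_uniq //= eqxx eE // big1.
    by rewrite addr0 mulrC.
  by move=> a /negPf na; rewrite eq_sym na.
have Gm_M (u v : {ffun 'I_r -> k}) : in_Gm u -> in_Gm v -> in_Gm (u * v).
  by move=> u0 v0 j; rewrite ffunE mulf_neq0.
have Gm_f (u : 'I_r -> k) : (forall j, u j != 0) -> in_Gm (finfun u).
  by move=> u0 j; rewrite ffunE.
have Ef a (u : 'I_r -> k) : lmon a (finfun u) = lmon a u.
  by apply: eq_lmon => j; rewrite ffunE.
exists S, A; split=> //; first exact: undup_uniq.
- move=> a b aS bS; apply/incP => x y.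
  pose C a b := (A a * A b) (x, y).
  (* Independence is used twice: here for the characters of [u] with [v] fixed, then for those of
     [v]. *)
  have key (v : 'I_r -> k) : (forall j, v j != 0) ->
      A a (x, y) * lmon a v - \sum_(b <- S) C a b * lmon b v = 0.
    move=> v0; move: a aS {b bS}; apply: lmon_free; first exact: undup_uniq.
    move=> u u0; under eq_bigr => a _ do rewrite mulrBl.
    rewrite sumrB; apply/eqP; rewrite subr_eq0; apply/eqP.
    have uG := Gm_f u u0; have vG := Gm_f v v0.
    have := congr1 (fun g => uval g (x, y)) (phiM _ _ uG vG).
    rewrite (phiE _ (Gm_M _ _ uG vG)) => E.
    transitivity (\sum_(a <- S) lmon a ((finfun u : {ffun _}) * finfun v) * A a (x, y)).
      apply: eq_bigr => a _; rewrite -mulrA mulrC; congr (_ * _).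
      by rewrite mulrC -lmonM; apply: eq_lmon => j; rewrite !ffunE.
    rewrite {}E [LHS]inc_convE.
    under eq_bigr => z _.
      rewrite (phiE _ uG) (phiE _ vG) mulr_suml.
      under eq_bigr => a _ do rewrite mulr_sumr.
      over.
    rewrite exchange_big; apply: eq_bigr => a _ /=.
    rewrite exchange_big mulr_suml; apply: eq_bigr => b _ /=.
    rewrite /C inc_convE !mulr_suml; apply: eq_bigr => z _.
    by rewrite !Ef; ring.
  suff : (if b == a then A a (x, y) else 0) - C a b = 0.
    move=> /eqP; rewrite subr_eq0 => /eqP E.
    rewrite -[LHS]/(C a b) -E (eq_sym b).
    by case: eqP => // _; rewrite [RHS]ffunE.
  move: b bS; apply: lmon_free; first exact: undup_uniq.
  move=> v v0; rewrite -[RHS](key v v0).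
  under eq_bigr => b _ do rewrite mulrBl.
  rewrite sumrB; congr (_ - _); rewrite (bigD1_seq a) ?undup_uniq //= eqxx.
  by rewrite big1 ?addr0 // => b /negPf ->; rewrite mul0r.
- have Gm1 : in_Gm (finfun (fun=> 1) : {ffun 'I_r -> k}).
    by apply: Gm_f => j; apply: oner_neq0.
  (* The image of 1 is an idempotent unit. *)
  have phi1 : uval (phi (finfun (fun=> 1))) = 1.
    have := phiM _ _ Gm1 Gm1; rewrite (_ : _ * _ = finfun (fun=> 1)).
      set g := phi _ => /(congr1 (fun h => uinv g * uval h)).
      by rewrite [RHS]mulrA uvalVl mul1r.
    by apply/ffunP => j; rewrite !ffunE mulr1.
  apply/incP => x y; have := phiE _ Gm1 x y; rewrite phi1 inc_sumE => E.
  rewrite [RHS]E; apply: eq_bigr => a _; rewrite Ef lmon1 mul1r //.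
Qed.

(* If A_i are orthogonal idempotents of sum 1 and E_i their diagonal parts, then
   g = sum_i A_i E_i is unitriangular and A_i g = A_i E_i = g E_i. *)
Lemma torus_conj_diag (T : G -> Prop) : is_torus T ->
  exists g, forall h, T h -> conj_diag g h.
Proof.
case=> _ [r [phi [psi isoT]]].
have [S [A [uS phiE AA A1]]] := torus_idempotents isoT.
pose E a := inc_diag (fun x => A a (x, x)).
have AAx a b x : a \in S -> b \in S ->
    A a (x, x) * A b (x, x) = if a == b then A a (x, x) else 0.
  by move=> aS bS; rewrite -inc_mul_diag AA //; case: eqP => // _; rewrite ffunE.
have [g gE] : exists g : G, uval g = \sum_(a <- S) A a * E a.
  apply: unitriangular_unit => x; rewrite inc_sumE.
  transitivity ((1 : I) (x, x)); last by rewrite inc_oneE eqxx.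
  rewrite -A1 inc_sumE.
  rewrite !big_seq; apply: eq_bigr => a aS.
  by rewrite inc_mul_diag inc_diagE eqxx AAx // eqxx.
have Ag a : a \in S -> A a * uval g = A a * E a.
  move=> aS; rewrite gE mulr_sumr (bigD1_seq a) //= big_seq_cond big1 ?addr0.
    by rewrite mulrA AA // eqxx.
  by move=> b /andP[bS nb]; rewrite mulrA AA // eq_sym (negPf nb) mul0r.
have gEa a : a \in S -> uval g * E a = A a * E a.
  move=> aS; rewrite gE mulr_suml (bigD1_seq a) //= big_seq_cond big1 ?addr0.
    rewrite -mulrA inc_diagM; congr (_ * _); apply/incP => x y.
    by rewrite !inc_diagE AAx // eqxx.
  move=> b /andP[bS nb]; rewrite -mulrA inc_diagM.
  rewrite (_ : inc_diag _ = 0) ?mulr0 //; apply/incP => x y.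
  by rewrite inc_diagE AAx // (negPf nb) if_same [RHS]ffunE.
exists g => h Th x y nxy.
case: isoT => -[_ psiT _ phiK] _ _ _.
rewrite -(phiK h Th); have u0 := psiT h Th; set u := psi h in u0 *.
have -> : uval (phi u) = \sum_(a <- S) inc_scale (lmon a u) (A a).
  apply/incP => x' y'; rewrite phiE // inc_sumE.
  by apply: eq_bigr => a _; rewrite inc_scaleE.
(* Each summand is diagonal, because $g^{-1}A_a g = g^{-1}A_aE_a = E_a$. *)
rewrite conj_actE mulr_sumr mulr_suml inc_sumE big_seq big1 // => a aS.
rewrite inc_scaleAr inc_scaleAl inc_scaleE -mulrA Ag // -gEa //.
by rewrite mulrA uvalVl mul1r inc_diagE (negPf nxy) mulr0.
Qed.

Lemma maximal_torus_conj_diag (T : G -> Prop) : maximal_torus T ->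
  exists g, forall h, T h <-> conj_diag g h.
Proof.
case=> torT maxT; have [g Tg] := torus_conj_diag torT.
by exists g => h; split; [apply: Tg | apply: maxT => //; apply: conj_diag_torus].
Qed.

End ToriAreDiagonalizable.

(** * Spanning trees and their potentials *)

Section SpanningTree.

Context (F : fieldType) (N : nat) (V : finType) (src tgt : 'I_N -> V) (r : V).
(** Connectedness is expressed through cuts, so that a tree which is not yet spanning always has an
    edge to grow along. *)
Context (crossing : forall S : {set V}, r \in S -> S != setT ->
  exists j, (src j \in S) != (tgt j \in S)).

(* The action of F^*^V on edge weights; for V = P + P, src (x, y) = inl x and
   tgt (x, y) = inr y it is that of the pairs of diagonal units on I(P). *)
Definition rescale (w : V -> F) (x : 'I_N -> F) : 'I_N -> F :=
  fun j => w (src j) * x j / w (tgt j).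

Lemma rescale_neq0 w x : (forall v, w v != 0) -> (forall j, x j != 0) ->
  forall j, rescale w x j != 0.
Proof. by move=> w0 x0 j; rewrite /rescale !mulf_neq0 ?invr_eq0. Qed.

(* B is the edge set of a tree on S, and h v is the signed sum of the edges of
   the path of B from r to v. *)
Definition tree_on (S : {set V}) (B : {set 'I_N}) (h : V -> {ffun 'I_N -> int}) :
    Prop :=
  [/\ r \in S /\ #|B|.+1 = #|S|,
      forall j, j \in B -> (src j \in S) && (tgt j \in S),
      forall v j, j \notin B -> h v j = 0,
      forall j, j \in B -> h (tgt j) = h (src j) + unit_exp j &
      forall v (w : V -> F) (x : 'I_N -> F), v \in S ->
        (forall u, w u != 0) -> (forall j, x j != 0) ->
        lmon (h v) (rescale w x) = w r / w v * lmon (h v) x].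

Lemma tree_on_root : tree_on [set r] set0 (fun=> 0).
Proof.
split.
- by rewrite set11 cards1 cards0.
- by move=> j; rewrite in_set0.
- by move=> v j _; rewrite /= ffunE.
- by move=> j; rewrite in_set0.
- by move=> v w x /set1P -> w0 _; rewrite /= !lmon0 divff ?mulr1.
Qed.

(** Treats both orientations of the new edge [j] at once: [v] is its endpoint outside the tree, and
    [e] prolongs the potential [h] to [v]. *)
Lemma tree_on_add S B h v j (e : V -> {ffun 'I_N -> int}) :
    tree_on S B h -> v \notin S -> v \in [set src j; tgt j] ->
    (src j \in v |: S) && (tgt j \in v |: S) ->
    [/\ e (tgt j) = e (src j) + unit_exp j,
        forall u, u != v -> e u = h u,
        forall i, i \notin j |: B -> e v i = 0 &
        forall (w : V -> F) (x : 'I_N -> F),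
          (forall u, w u != 0) -> (forall j, x j != 0) ->
          lmon (e v) (rescale w x) = w r / w v * lmon (e v) x] ->
  tree_on (v |: S) (j |: B) e.
Proof.
move=> [[rS cS] BS hB hE hw] vS vj jS' [ej eh ev ew].
have jB : j \notin B.
  by apply: contra vS => /BS /andP[s t]; move: vj; rewrite !inE => /orP[]/eqP ->.
have neq_v u : u \in S -> u != v by apply: contraTneq => ->.
split.
- by rewrite inE rS orbT !cardsU1 vS jB -cS.
- by move=> i /setU1P[->|/BS /andP[s t]] //; rewrite !inE s t !orbT.
- move=> u i; case: (eqVneq u v) => [->|nuv]; first exact: ev.
  by rewrite inE negb_or eh // => /andP[_]; apply: hB.
- move=> i /setU1P[->|iB] //; have /andP[s t] := BS i iB.
  by rewrite !eh ?neq_v // hE.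
- move=> u w x; case: (eqVneq u v) => [-> _|nuv]; first exact: ew.
  by rewrite inE in_set1 (negPf nuv) eh //; apply: hw.
Qed.

Lemma tree_on_grow S B h : tree_on S B h -> S != setT ->
  exists S' B' h', tree_on S' B' h' /\ #|S'| = #|S|.+1.
Proof.
move=> treeS ST; have [[rS cS] BS hB hE hw] := treeS.
suff [v [j [e [vS]]]] : exists v j e,
    v \notin S /\ tree_on (v |: S) (j |: B) e.
  by exists (v |: S), (j |: B), e; rewrite cardsU1 vS.
have [j cross] := crossing rS ST.
move: cross; case: (boolP (src j \in S)) => sS tS.
  have {}tS : (tgt j \in S) = false by move: tS; case: (_ \in _).
  have nst : src j != tgt j by apply: contraFneq tS => <-.
  (* Here [j] points out of the tree and prolongs the path with sign plus; in the other case it is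
     traversed backwards, with sign minus. *)
  exists (tgt j), j,
    (fun u => if u == tgt j then h (src j) + unit_exp j else h u).
  rewrite tS; split=> //; apply: (tree_on_add treeS); rewrite ?tS //.
  - by rewrite !inE eqxx orbT.
  - by rewrite !inE sS eqxx orbT.
  split=> [|u /negPf -> //|i|w x w0 x0]; rewrite eqxx ?(negPf nst) //.
    by rewrite inE in_set1 negb_or !ffunE => /andP[/negPf -> /hB ->]; rewrite addr0.
  have y0 := rescale_neq0 w0 x0.
  rewrite !lmonD // !lmon_unit_exp hw // /rescale.
  have := w0 (src j); have := w0 (tgt j); move=> ? ?; field.
  by apply/andP.
have {}tS : tgt j \in S by move: tS; case: (_ \in _).
have nst : tgt j != src j by apply: contraNneq sS => <-.
exists (src j), j, (fun u => if u == src j then h (tgt j) - unit_exp j else h u).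
split=> //; apply: (tree_on_add treeS) => //.
- by rewrite !inE eqxx.
- by rewrite !inE tS eqxx orbT.
split=> [|u /negPf -> //|i|w x w0 x0]; rewrite eqxx ?(negPf nst) ?subrK //.
  rewrite inE in_set1 negb_or ffunE => /andP[/negPf ni /hB ->].
  by rewrite !ffunE ni oppr0 addr0.
have y0 := rescale_neq0 w0 x0.
rewrite !lmonB // !lmon_unit_exp hw // /rescale.
have := w0 (src j); have := w0 (tgt j); have := x0 j; move=> ? ? ?; field.
by do ?[apply/andP; split].
Qed.

Lemma spanning_tree : exists B h, tree_on setT B h.
Proof.
have grow n : (n < #|V|)%N -> exists S B h, tree_on S B h /\ #|S| = n.+1.
  elim: n => [_|n IH ltnV].
    by exists [set r], set0, (fun=> 0); rewrite cards1; split=> //; apply: tree_on_root.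
  have [S [B [h [treeS cS]]]] := IH (ltnW ltnV).
  have [|S' [B' [h' [treeS' cS']]]] := tree_on_grow treeS.
    by apply: contraTneq ltnV => ST; rewrite -cardsT -ST cS ltnn.
  by exists S', B', h'; rewrite cS' cS.
have V0 : (0 < #|V|)%N by apply/card_gt0P; exists r.
have [|S [B [h [treeS cS]]]] := grow #|V|.-1; first by rewrite prednK.
exists B, h; have /eqP <- // : S == setT.
by rewrite eqEcard subsetT cardsT cS prednK ?leqnn.
Qed.

End SpanningTree.

(** * Connectedness of the bipartite graph of intervals *)

Section IntervalGraph.

Context {d : Order.disp_t} (P : finPOrderType d).
Local Notation N := (inc_dim P).

Definition edge_src (j : 'I_N) : P + P := inl (val (enum_val j)).1.
Definition edge_tgt (j : 'I_N) : P + P := inr (val (enum_val j)).2.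

(** If no edge crossed, the edges $x\le x$ would tie together the two copies of each element and the
    covers would carry membership along the Hasse diagram, so [S] would be everything. *)
Lemma interval_graph_crossing (p0 : P) (S : {set P + P}) :
  connected_poset P -> inl p0 \in S -> S != setT ->
  exists j, (edge_src j \in S) != (edge_tgt j \in S).
Proof.
move=> [_ connP] p0S; case: (pickP (fun j => (edge_src j \in S) != (edge_tgt j \in S))).
  by move=> j nj _; exists j.
move=> noX /eqP[]; have le_S x y : (x <= y)%O -> (inl x \in S) = (inr y \in S).
  move=> le_xy; have /negbFE /eqP := noX (inc_index le_xy).
  by rewrite /edge_src /edge_tgt val_inc_index.
have inlS x : inl x \in S.
  have : closed [rel u v | covers u v || covers v u] [pred x | inl x \in S].
    move=> u v; rewrite !inE => /orP[] /andP[/ltW le_uv _].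
      by rewrite (le_S _ _ le_uv) (le_S v v).
    by rewrite (le_S _ _ le_uv) (le_S u u).
  by move=> /closed_connect cl; have := cl _ _ (connP p0 x); rewrite !inE p0S.
by apply/setP => -[x|x]; rewrite inE ?inlS // -(le_S x x) ?inlS.
Qed.

End IntervalGraph.

(** * Values of rational functions at points *)

Section RationalValues.

Context (k : fieldType) (N : nat).
Local Notation R := {mpoly k[N]}.
Local Notation E := {fraction {mpoly k[N]}}.
Local Notation "p %:F" := (FracField.tofrac p).
Implicit Types (f g : E) (p q : R) (x : 'I_N -> k).

(* A relation, as the numerator and denominator of repr f may share factors
   that vanish at x. *)
Definition has_value f x (a : k) : Prop :=
  exists p q, [/\ f = p%:F / q%:F, q.@[x] != 0 & a = p.@[x] / q.@[x]].

Lemma meval_neq0 q x : q.@[x] != 0 -> q != 0.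
Proof. by apply: contraNneq => ->; rewrite meval0. Qed.

Lemma value_tofrac p x : has_value p%:F x p.@[x].
Proof. by exists p, 1; rewrite tofrac1 meval1 !divr1 oner_neq0. Qed.

Lemma valueD f g x a b :
  has_value f x a -> has_value g x b -> has_value (f + g) x (a + b).
Proof.
move=> [p [q [-> q0 ->]]] [p' [q' [-> q'0 ->]]].
exists (p * q' + p' * q), (q * q').
rewrite mevalD !mevalM mulf_neq0 //; split=> //; last by rewrite addf_div.
by rewrite addf_div ?tofrac_eq0 ?(meval_neq0 q0) ?(meval_neq0 q'0) // tofracD !tofracM.
Qed.

Lemma valueM f g x a b :
  has_value f x a -> has_value g x b -> has_value (f * g) x (a * b).
Proof.
move=> [p [q [-> q0 ->]]] [p' [q' [-> q'0 ->]]].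
exists (p * p'), (q * q').
by rewrite !mevalM mulf_neq0 // !tofracM !mulf_div.
Qed.

Lemma valueV f x a : has_value f x a -> a != 0 -> has_value f^-1 x a^-1.
Proof.
move=> [p [q [-> q0 ->]]] a0; exists q, p; rewrite !invf_div; split=> //.
by apply: contraNneq a0 => ->; rewrite mul0r.
Qed.

Lemma value_sum J (r : seq J) (F : J -> E) x (a : J -> k) :
  (forall j, has_value (F j) x (a j)) ->
  has_value (\sum_(j <- r) F j) x (\sum_(j <- r) a j).
Proof.
move=> Fa; elim/big_rec2: _ => [|j b f _ fb]; last exact: valueD.
by have := value_tofrac 0 x; rewrite tofrac0 meval0.
Qed.

Lemma value_prod J (r : seq J) (F : J -> E) x (a : J -> k) :
  (forall j, has_value (F j) x (a j)) ->
  has_value (\prod_(j <- r) F j) x (\prod_(j <- r) a j).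
Proof.
move=> Fa; elim/big_rec2: _ => [|j b f _ fb]; last exact: valueM.
by have := value_tofrac 1 x; rewrite tofrac1 meval1.
Qed.

Lemma valueX f x a n : has_value f x a -> has_value (f ^+ n) x (a ^+ n).
Proof.
move=> fa; elim: n => [|n IH]; last by rewrite !exprS; apply: valueM.
by have := value_tofrac 1 x; rewrite tofrac1 meval1.
Qed.

Lemma value_exprz f x a (z : int) :
  has_value f x a -> a != 0 -> has_value (f ^ z) x (a ^ z).
Proof.
move=> fa a0; case: z => n; first exact: valueX.
by apply: valueV; [apply: valueX | rewrite expf_neq0].
Qed.

Lemma value_lmon n (e : {ffun 'I_n -> int}) (F : 'I_n -> E) x (a : 'I_n -> k) :
  (forall j, has_value (F j) x (a j)) -> (forall j, a j != 0) ->
  has_value (lmon e F) x (lmon e a).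
Proof. by move=> Fa a0; apply: value_prod => j; apply: value_exprz. Qed.

Lemma value_mmap n (Q : {mpoly k[n]}) (F : 'I_n -> E) x (a : 'I_n -> k) :
  (forall j, has_value (F j) x (a j)) ->
  has_value (mmap (fun c : k => (c%:MP_[N])%:F) F Q) x Q.@[a].
Proof.
move=> Fa; rewrite mevalE; apply: value_sum => m; apply: valueM.
  by have := value_tofrac (Q@_m)%:MP_[N] x; rewrite mevalC.
by apply: value_prod => j; apply: valueX.
Qed.

(** The conclusion is free of division and so covers points where [q] vanishes. Taking [p = 0],
    [q = 1] shows that 0 has no value but 0. *)
Lemma value_frac p q x a : q != 0 ->
  has_value (p%:F / q%:F) x a -> p.@[x] = a * q.@[x].
Proof.
move=> q0 [p' [q' [E q'0 ->]]].
have : p * q' = p' * q.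
  apply/eqP; rewrite -(tofrac_eq (p * _)) !tofracM -eqr_div ?tofrac_eq0 ?E //.
  exact: meval_neq0 q'0.
move=> /(congr1 (meval x)); rewrite !mevalM => E'.
by rewrite mulrAC -E' mulfK.
Qed.

End RationalValues.

(** * The torus action in conjugated coordinates *)

Section ConjugatedCoordinates.

Context (k : closedFieldType) {d : Order.disp_t} (P : finPOrderType d).
Local Notation G := (inc_unit k P).
Local Notation I := (incidence k P).
Local Notation N := (inc_dim P).
Local Notation E := {fraction {mpoly k[N]}}.
Local Notation "p %:F" := (FracField.tofrac p).
Implicit Types (s t : G) (y : 'I_N -> k) (w : P + P -> k) (p q : {mpoly k[N]}).

Local Notation edge_rescale := (rescale (@edge_src d P) (@edge_tgt d P)).

Context (g : G).
Local Notation T := (conj_diag g).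

(* The linear change of variables x = g y g^-1, after which g D g^-1 acts on y
   by rescaling the coordinates. *)
Definition pt y : I := inc_act g g (inc_of y).

Definition ycoord (j : 'I_N) : {mpoly k[N]} := coact g^-1%g g^-1%g 'X_j.

Lemma conj_act_pt y : inc_act g^-1%g g^-1%g (pt y) = inc_of y.
Proof.
rewrite conj_actE /pt /inc_act -[uval g^-1%g]/(uinv g) !mulrA uvalVl mul1r.
by rewrite -mulrA uvalVl mulr1.
Qed.

Lemma meval_ycoord j y : (ycoord j).@[inc_coord (pt y)] = y j.
Proof. by rewrite coactE conj_act_pt mevalXU inc_ofK. Qed.

Lemma meval_pt p y : p.@[inc_coord (pt y)] = (coact g g p).@[y].
Proof.
by rewrite -coactE; have := meval_eq (coact g g p) (inc_ofK y) => ->.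
Qed.

Lemma coact_neq0 s t p : p != 0 -> coact s t p != 0.
Proof.
by apply: contra_neq => p0; rewrite -(coactK s t p) p0 /coact raddf0.
Qed.

(** Density of the torus, transported by the invertible change of variables. *)
Lemma mpoly_eq0_pt p :
  (forall y, (forall j, y j != 0) -> p.@[inc_coord (pt y)] = 0) -> p = 0.
Proof.
move=> p0; rewrite -(coactK g g p) (_ : coact g g p = 0) /coact ?raddf0 //.
by apply: mpoly_eq0_torus => y y0; rewrite -/(coact g g p) -meval_pt p0.
Qed.

Definition weights s t : P + P -> k :=
  fun v => match v with inl a => uval s (a, a) | inr b => uval t (b, b) end.

Lemma weights_neq0 s t v : weights s t v != 0.
Proof. by case: v => a; apply: uval_diag_neq0. Qed.

Lemma inc_of_rescale s t y :
  inc_diag (fun x => uval s (x, x)) * inc_of y * inc_diag (fun x => uinv t (x, x)) =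
  inc_of (edge_rescale (weights s t) y).
Proof.
apply: inc_coord_inj => j; rewrite inc_ofK /rescale -[y j](inc_ofK y) /inc_coord.
rewrite /edge_src /edge_tgt; case: (val (enum_val j)) => a b.
by rewrite inc_diag_mulr inc_diag_mull uinv_diagE.
Qed.

Lemma act_pt s t y : T s -> T t ->
  inc_act s t (pt y) = pt (edge_rescale (weights s t) y).
Proof.
move=> Ts Tt; rewrite /pt -inc_of_rescale -(conj_diagP Ts) -(conj_diag_inv Tt).
rewrite /inc_act -[uval g^-1%g]/(uinv g) -[uval t^-1%g]/(uinv t) !mulrA uvalV mul1r.
by rewrite -(mulrA _ (uval g) (uinv g)) uvalV mulr1.
Qed.

(** Conjugation by [g] keeps diagonal entries, so these can be prescribed for [s] and [t]
    independently. *)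
Lemma weights_surj w : (forall v, w v != 0) ->
  exists s t, [/\ T s, T t & weights s t =1 w].
Proof.
move=> w0.
have key (u : P -> k) : (forall x, u x != 0) ->
    exists2 s, T s & forall x, uval s (x, x) = u x.
  move=> u0; exists (g * diag_unit u * g^-1)%g.
    by apply: (@conj_diagI _ _ _ _ _ u); rewrite -diag_unitE.
  move=> x; rewrite -[uval _]/(uval g * uval (diag_unit u) * uinv g) diag_unitE //.
  rewrite !inc_mul_diag inc_diagE eqxx uinv_diagE mulrAC mulfV ?mul1r //.
  exact: uval_diag_neq0.
have [s Ts sE] := key (fun x => w (inl x)) (fun x => w0 _).
have [t Tt tE] := key (fun x => w (inr x)) (fun x => w0 _).
by exists s, t; split=> // -[x|x] /=; rewrite ?sE ?tE.
Qed.

Lemma eq_rescale w w' y : w =1 w' ->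
  edge_rescale w y =1
  edge_rescale w' y.
Proof. by move=> E j; rewrite /rescale !E. Qed.

Lemma eq_pt y y' : y =1 y' -> pt y = pt y'.
Proof.
move=> E; congr (inc_act _ _ _); apply: inc_coord_inj => j.
by rewrite !inc_ofK E.
Qed.

(** After cross-multiplication invariance is a polynomial identity, which can be tested on the dense
    set of points [pt y]. *)
Lemma invariant_of_values (f : E) :
    (forall s t y, T s -> T t -> (forall j, y j != 0) -> exists a,
       has_value f (inc_coord (pt y)) a /\
       has_value f (inc_coord (inc_act s t (pt y))) a) ->
  Defs.invariant T f.
Proof.
move=> fv s t Ts Tt; have q0 := denom_ratioP (repr f).
have Ef : f = (\n_(repr f))%:F / (\d_(repr f))%:F by rewrite -fracE reprK.
rewrite [RHS]Ef /rat_coact; apply/eqP.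
rewrite eqr_div ?tofrac_eq0 ?coact_neq0 // -!tofracM tofrac_eq -subr_eq0.
apply/eqP/mpoly_eq0_pt => y y0; rewrite mevalB !mevalM !coactE.
have [a [fa fa']] := fv s t y Ts Tt y0; rewrite Ef in fa fa'.
by rewrite (value_frac q0 fa) (value_frac q0 fa'); ring.
Qed.

Lemma invariant_cross (f : E) s t x : Defs.invariant T f -> T s -> T t ->
  (\n_(repr f)).@[inc_coord (inc_act s t x)] * (\d_(repr f)).@[inc_coord x] =
  (\n_(repr f)).@[inc_coord x] * (\d_(repr f)).@[inc_coord (inc_act s t x)].
Proof.
move=> invf Ts Tt; have q0 := denom_ratioP (repr f).
have Ef : f = (\n_(repr f))%:F / (\d_(repr f))%:F by rewrite -fracE reprK.
have := invf s t Ts Tt; rewrite [RHS]Ef /rat_coact => /eqP.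
rewrite eqr_div ?tofrac_eq0 ?coact_neq0 // -!tofracM tofrac_eq => /eqP.
by move=> /(congr1 (meval (inc_coord x))); rewrite !mevalM !coactE.
Qed.

(** * Cycle monomials as a transcendence basis of the invariants *)

Section Complexity.

Context (r : P + P) (B : {set 'I_N}) (h : P + P -> {ffun 'I_N -> int}).
Hypothesis treeB : tree_on k (@edge_src d P) (@edge_tgt d P) r setT B h.

(** The fundamental cycle of [e]: from the root to its source, along [e], and back from its
    target. *)
Definition cycle_exp (e : 'I_N) : {ffun 'I_N -> int} :=
  h (edge_src e) + unit_exp e - h (edge_tgt e).

Lemma cycle_exp_tree e : e \in B -> cycle_exp e = 0.
Proof. by case: treeB => _ _ _ hE _ /hE; rewrite /cycle_exp => ->; rewrite subrr. Qed.

Lemma lmon_cycle_exp e y : (forall j, y j != 0) ->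
  lmon (cycle_exp e) y = lmon (h (edge_src e)) y * y e / lmon (h (edge_tgt e)) y.
Proof. by move=> y0; rewrite lmonB // lmonD // lmon_unit_exp. Qed.

(** Apart from [e] itself the cycle runs through tree edges only. *)
Lemma lmon_cycle_off e y : e \notin B -> (forall j, j \in B -> y j = 1) ->
  lmon (cycle_exp e) y = y e.
Proof.
case: treeB => _ _ hB _ _ eB y1.
rewrite -[RHS]lmon_unit_exp; apply: eq_bigr => j _.
case: (boolP (j \in B)) => [/y1 ->|jB]; first by rewrite !exp1rz.
by rewrite !ffunE !hB // add0r oppr0 addr0.
Qed.

(** The vertex weights telescope around a closed cycle. *)
Lemma lmon_cycle_rescale e w y : (forall v, w v != 0) -> (forall j, y j != 0) ->
  lmon (cycle_exp e) (edge_rescale w y) = lmon (cycle_exp e) y.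
Proof.
case: treeB => _ _ _ _ hw w0 y0; have ry0 := rescale_neq0 (@edge_src d P) (@edge_tgt d P) w0 y0.
rewrite !lmon_cycle_exp // !hw ?inE // /rescale.
have := w0 (edge_src e); have := w0 (edge_tgt e); have := w0 r.
have := lmon_neq0 (h (edge_tgt e)) y0; move=> ? ? ? ?; field.
by do ?[apply/andP; split].
Qed.

(* Rescaling by the potentials moves every point with nonzero coordinates to
   one whose tree coordinates are those of y0. *)
Definition normalizer y0 y : P + P -> k := fun v => lmon (h v) y / lmon (h v) y0.

Lemma normalizer_neq0 y0 y v :
  (forall j, y0 j != 0) -> (forall j, y j != 0) -> normalizer y0 y v != 0.
Proof. by move=> h0 h1; rewrite mulf_neq0 ?invr_eq0 ?lmon_neq0. Qed.

Lemma rescale_normalizer y0 y e :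
  (forall j, y0 j != 0) -> (forall j, y j != 0) ->
  edge_rescale (normalizer y0 y) y e =
  y0 e / lmon (cycle_exp e) y0 * lmon (cycle_exp e) y.
Proof.
move=> y00 yn0; rewrite !lmon_cycle_exp // /rescale /normalizer.
have := lmon_neq0 (h (edge_tgt e)) y00; have := lmon_neq0 (h (edge_tgt e)) yn0.
have := lmon_neq0 (h (edge_src e)) y00; have := lmon_neq0 (h (edge_src e)) yn0.
have := y00 e; move=> ? ? ? ? ?; field.
by do ?[apply/andP; split].
Qed.

Local Notation c := #|~: B|.

Definition cycle_mon (e : 'I_N) : E :=
  lmon (cycle_exp e) (fun j => (ycoord j)%:F).

Definition cycle_basis : c.-tuple E :=
  [tuple cycle_mon (enum_val i) | i < c].

Lemma cycle_mon_value e y : (forall j, y j != 0) ->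
  has_value (cycle_mon e) (inc_coord (pt y)) (lmon (cycle_exp e) y).
Proof.
move=> y0; apply: value_lmon => // j; rewrite -(meval_ycoord j).
exact: value_tofrac.
Qed.

Lemma cycle_mon_invariant e : Defs.invariant T (cycle_mon e).
Proof.
apply: invariant_of_values => s t y Ts Tt y0.
exists (lmon (cycle_exp e) y); split; first exact: cycle_mon_value.
have w0 := weights_neq0 s t.
rewrite act_pt // -(lmon_cycle_rescale e w0 y0).
by apply: cycle_mon_value; apply: rescale_neq0 => // v; apply: weights_neq0.
Qed.

Definition extend (A : Type) (y0 : 'I_N -> A) (z : 'I_c -> A) : 'I_N -> A :=
  fun j => if [pick i | enum_val i == j] is Some i then z i else y0 j.

Lemma extend_val A (y0 : 'I_N -> A) (z : 'I_c -> A) i :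
  extend y0 z (enum_val i) = z i.
Proof.
rewrite /extend; case: pickP => [i' /eqP/enum_val_inj -> //|/(_ i)].
by rewrite eqxx.
Qed.

Lemma extend_tree A (y0 : 'I_N -> A) (z : 'I_c -> A) j :
  j \in B -> extend y0 z j = y0 j.
Proof.
rewrite /extend; case: pickP => // i /eqP <-.
by have := enum_valP i; rewrite inE => /negPf ->.
Qed.

Lemma not_tree_enum j : j \notin B -> exists i : 'I_c, j = enum_val i.
Proof.
rewrite -in_setC => jB; exists (enum_rank_in jB j).
by rewrite enum_rankK_in.
Qed.

(** With all tree coordinates set to 1, the cycle monomials take arbitrary nonzero values [z], so a
    relation among them vanishes on the torus. *)
Lemma cycle_basis_indep :
  alg_indep (fun a : k => (a%:MP_[N])%:F) cycle_basis.
Proof.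
move=> Q Q0; apply: mpoly_eq0_torus => z z0.
pose y := extend (fun=> 1) z.
have y1 j : j \in B -> y j = 1 by apply: extend_tree.
have y0 j : y j != 0.
  case: (boolP (j \in B)) => [/y1 ->|/not_tree_enum[i ->]]; first exact: oner_neq0.
  by rewrite /y extend_val.
have v j : has_value (tnth cycle_basis j) (inc_coord (pt y)) (z j).
  rewrite tnth_mktuple -(extend_val (fun=> 1) z j) -/y.
  have jB := enum_valP j; rewrite inE in jB.
  rewrite -(lmon_cycle_off jB y1).
  exact: cycle_mon_value.
have := value_mmap Q v; rewrite Q0 => v0.
have := @value_frac k N 0 1 (inc_coord (pt y)) Q.@[z].
by rewrite tofrac0 mul0r oner_neq0 meval0 meval1 mulr1 => /(_ isT v0).
Qed.

Lemma cycle_basis_maximal (f : E) : Defs.invariant T f ->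
  ~ alg_indep (fun a : k => (a%:MP_[N])%:F) [tuple of f :: cycle_basis].
Proof.
move=> invf indep; set p := \n_(repr f); set q := \d_(repr f).
have q0 : q != 0 := denom_ratioP (repr f).
have Ef : f = p%:F / q%:F by rewrite -fracE reprK.
(* As [q] is nonzero, some [pt y0] with nonzero coordinates satisfies $q\ne 0$; this [y0] supplies
   the constants for normalization. *)
apply/negP: (coact_neq0 g g q0); rewrite negbK; apply/eqP.
apply: mpoly_eq0_torus => y0 y00; apply/eqP; apply: contraT => qy0; exfalso.
(* Coordinates of the normalized point as polynomials in the cycle monomials; variable 0 is reserved
   for [f]. *)
pose L : N.-tuple {mpoly k[c.+1]} :=
  [tuple extend (fun j => (y0 j)%:MP)
    (fun i => (y0 (enum_val i) / lmon (cycle_exp (enum_val i)) y0) *: 'X_(lift ord0 i)) j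
  | j < N].
pose Q : {mpoly k[c.+1]} := 'X_ord0 * (coact g g q \mPo L) - (coact g g p \mPo L).
pose val a y : 'I_c.+1 -> k :=
  fun i => if unlift ord0 i is Some j then lmon (cycle_exp (enum_val j)) y else a.
have val0 a y : val a y ord0 = a by rewrite /val unlift_none.
have valS a y j : val a y (lift ord0 j) = lmon (cycle_exp (enum_val j)) y.
  by rewrite /val liftK.
have Lval a y : (forall j, y j != 0) -> forall j,
    (tnth L j).@[val a y] = edge_rescale (normalizer y0 y) y j.
  move=> yn0 j; rewrite tnth_mktuple rescale_normalizer //.
  case: (boolP (j \in B)) => [jB|/not_tree_enum[i ->]].
    by rewrite extend_tree // mevalC cycle_exp_tree // !lmon0 divr1 mulr1.
  by rewrite extend_val mevalZ mevalXU valS.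
have Qval a y : (forall j, y j != 0) -> Q.@[val a y] =
    a * (coact g g q).@[edge_rescale (normalizer y0 y) y]
    - (coact g g p).@[edge_rescale (normalizer y0 y) y].
  move=> yn0.
  have LE u : (u \mPo L).@[val a y] = u.@[edge_rescale (normalizer y0 y) y].
    by rewrite comp_mpoly_meval; apply: meval_eq => j; rewrite Lval.
  by rewrite mevalB mevalM mevalXU val0 !LE.
have Q0 : Q = 0.
  apply: indep; set F := mmap _ _ Q; have := denom_ratioP (repr F).
  have : F = (\n_(repr F))%:F / (\d_(repr F))%:F by rewrite -fracE reprK.
  set p' := \n_(repr F); set q' := \d_(repr F) => EF q'0.
  (* The factor [q] disposes of the points where the value of [f] cannot be computed as $p/q$. *)
  suff : p' * q = 0.
    by move=> /eqP; rewrite mulf_eq0 (negPf q0) orbF EF => /eqP ->; rewrite tofrac0 mul0r.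
  apply: mpoly_eq0_pt => y yn0; rewrite mevalM; set x := inc_coord (pt y).
  have [->|qx] := eqVneq q.@[x] 0; first exact: mulr0.
  have fx : has_value f x (p.@[x] / q.@[x]) by rewrite Ef; exists p, q.
  have Fx : has_value F x Q.@[val (p.@[x] / q.@[x]) y].
    apply: value_mmap => i; case: (unliftP ord0 i) => [j ->|->].
      rewrite tnthS tnth_mktuple valS; exact: cycle_mon_value.
    by rewrite tnth0 val0.
  rewrite EF in Fx; rewrite (value_frac q'0 Fx) Qval //.
  have [s [t [Ts Tt wE]]] :=
    weights_surj (fun v => normalizer_neq0 v y00 yn0).
  have := invariant_cross (pt y) invf Ts Tt; rewrite act_pt //.
  rewrite (eq_pt (eq_rescale y wE)) -/p -/q -/x !meval_pt => cross.
  rewrite [_ - _](_ : _ = 0) ?mul0r //; apply/eqP; rewrite subr_eq0; apply/eqP.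
  by rewrite mulrAC -cross mulfK // -meval_pt.
have norm1 : edge_rescale (normalizer y0 y0) y0 =1 y0.
  move=> j; rewrite rescale_normalizer // mulfVK //; exact: lmon_neq0.
(* Chosen so that $aq-p=1$ at [y0], which contradicts $Q=0$. *)
pose a := ((coact g g p).@[y0] + 1) / (coact g g q).@[y0].
have := Qval a y0 y00; rewrite Q0 meval0 !(meval_eq _ norm1) /a mulfVK //.
by move=> /eqP; rewrite addrAC subrr add0r eq_sym oner_eq0.
Qed.

Lemma conj_diag_complexity : complexity_eq T c.
Proof.
exists cycle_basis; split; last exact: cycle_basis_maximal.
  by move=> i; rewrite tnth_mktuple; apply: cycle_mon_invariant.
exact: cycle_basis_indep.
Qed.

End Complexity.

End ConjugatedCoordinates.

(** * The zeta polynomial at 2 and 3, and the final count *)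

Section Counting.

Context {d : Order.disp_t} (P : finPOrderType d).

Lemma card_multichains1 : #|multichains P 1| = #|P|.
Proof.
rewrite -[RHS]expn1 -(card_tuple 1 P); apply: eq_card => t.
by rewrite inE; case/tupleP: t => x t; rewrite [t]tuple0.
Qed.

Lemma card_multichains2 : #|multichains P 2| = inc_dim P.
Proof.
rewrite /inc_dim card_sig -[RHS]cardsE.
rewrite -(card_imset _ (f := fun p : P * P => [tuple p.1; p.2])); last first.
  by move=> [a b] [a' b'] /(congr1 val) /= [-> ->].
apply: eq_card => t; rewrite inE; apply/idP/imsetP => [|[p]].
  case/tupleP: t => x t; case/tupleP: t => y t; rewrite [t]tuple0 => /andP[xy _].
  by exists (x, y); rewrite ?inE //; apply: val_inj.
by rewrite !inE /= => p12 ->; rewrite /= p12.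
Qed.

End Counting.

Theorem theorem1p2 (k : closedFieldType) (d : Order.disp_t)
  (P : finPOrderType d) (P_connected : connected_poset P)
  (T : inc_unit k P -> Prop) (T_max : maximal_torus T)
  (Z : {poly rat}) (Z_zeta : is_zeta_poly P Z) :
  exists c : nat, complexity_eq T c /\ c%:R = Z.[3] - 2 * Z.[2] + 1.
Proof.
have [g Tg] := maximal_torus_conj_diag T_max.
have /card_gt0P[p0 _] := P_connected.1.
have [B [h treeB]] := spanning_tree k (fun S p0S ST =>
  interval_graph_crossing (S := S) P_connected p0S ST) (r := inl p0).
exists #|~: B|; split.
  have [s [sK sI sM]] := conj_diag_complexity g treeB.
  exists s; split=> // [i a b /Tg Ta /Tg Tb|f invf]; first exact: sK.
  by apply: sM => a b /Tg Ta /Tg Tb; apply: invf.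
(* A spanning tree on two copies of [P] has one edge fewer than the $2|P|$ vertices. *)
have cB : (#|B|.+1 = #|P| + #|P|)%N by case: treeB => -[_ ->]; rewrite cardsT card_sum.
have cN : (inc_dim P = #|B| + #|~: B|)%N by rewrite cardsC card_ord.
rewrite !Z_zeta // card_multichains1 card_multichains2 [in RHS]cN natrD.
have -> : 2 * #|P|%:R = #|B|%:R + 1 :> rat by rewrite natr1 cB natrD; ring.
by ring.
Qed.
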